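(* Fix $\delta\in(0,1)$ and a collection $\mathcal S$ of measurable sets with $\mathrm{VC}(\mathcal S)<+\infty$. Let $f_0\succeq f_1$ be trade-off functions, and let $$\psi_{n,\delta}(\mathcal S;X_{1:n},Y_{1:n})=\mathbf 1\bigl\{\exists S\in\mathcal S:\ h_+(Q_n(S^{c}))<f_0(h_+(P_n(S)))\bigr\}.$$ Then: (i) (Type I error control, assumption-free.) $$\sup_{(P,Q):\,T(P,Q)\succeq f_0}(P^n\times Q^n)(\psi_{n,\delta})\leq\delta,$$ where the supremum is over arbitrary pairs of distributions on $(\mathcal X,\mathcal A)$. (ii) (Type II error control under $\mathcal S$-attainability.) If for all $\alpha\in[0,1]$ $$f_1(\alpha)\leq h_+^{\leftarrow}\circ h_+^{\leftarrow}\circ f_0\circ h_+\circ h_+(\alpha),$$ then $$\sup_{(P,Q)\in\mathcal M_{\mathcal S}:\,T(P,Q)\not\succeq f_1}(P^n\times Q^n)(1-\psi_{n,\delta})\leq\delta .$$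
   Context: Trade-off functions: for probability distributions $P,Q$ on a measurable space $(\mathcal X,\mathcal A)$, $T(P,Q)(\alpha)=\inf\{E_Q[1-\varphi]:\ \varphi:\mathcal X\to[0,1]\text{ measurable},\ E_P[\varphi]\leq\alpha\}$, $\alpha\in[0,1]$. A trade-off function is a convex, continuous, non-increasing $f:[0,1]\to[0,1]$ with $f(\alpha)\leq1-\alpha$; it is extended by $f(\alpha)=0$ for $\alpha>1$. $f\succeq g$ means $f(\alpha)\geq g(\alpha)$ for all $\alpha\in[0,1]$; $f\not\succeq g$ means $f(\alpha_0)<g(\alpha_0)$ for some $\alpha_0\in[0,1]$. Data: $X_{1:n}\sim P^n$ and $Y_{1:n}\sim Q^n$ are independent samples, $P_n=\frac1n\sum_i\delta_{X_i}$, $Q_n=\frac1n\sum_i\delta_{Y_i}$ are the empirical distributions; $(P^n\times Q^n)(\psi)$ is the expectation of the test $\psi$ (value $1$ = rejection). VC dimension: a finite $A$ is shattered by $\mathcal S$ if $\mathrm{card}\{A\cap S:S\in\mathcal S\}=2^{\mathrm{card}(A)}$; $\mathrm{VC}(\mathcal S)$ is the largest cardinality of a shattered set. Confidence maps: $\tau_{n,\delta}=\frac{4\{\mathrm{VC}(\mathcal S)\log(2n)+\log(32/\delta)\}}{n}$, with $n$ always assumed large enough that $\tau_{n,\delta}\leq\frac12$; $V(t)=\min\{t,(1-t)_+\}$ and $h_+(t)=\min\{t+\sqrt{\tau_{n,\delta}V(t)}+\tau_{n,\delta},\,1\}$ for $t\in[0,\infty)$; $h_+^{\leftarrow}(t)=\inf\{s\in[0,1]:h_+(s)\geq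 t\}$ for $t\in[0,1]$. Attainability: for a class $\mathcal S\subset\mathcal A$ containing $\emptyset$ and $\mathcal X$, a pair $(P,Q)$ is $\mathcal S$-attainable if, with $\mu=(P+Q)/2$, $p=dP/d\mu$, $q=dQ/d\mu$, for every $\lambda\in[0,\infty]$ there is $S\in\mathcal S$ with $\mathbf 1_S=\mathbf 1_{\{q>\lambda p\}}$ $\mu$-a.e. (for $\lambda=\infty$, $\{q>\lambda p\}$ means $\{p=0\}$). $\mathcal M_{\mathcal S}$ is the collection of all $\mathcal S$-attainable pairs.
   Formalization: Part (i) also assumes that, for all P and m, the event that S cuts out a given index pattern from X_1:m is measurable for the completion of P^m (else ψ may be nonmeasurable and its expectation undefined); expectations of ψ and 1−ψ are outer expectations. *)

(* Defs.v *)
From HB Require Import structures.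
From mathcomp Require Import all_boot all_order all_algebra.
From mathcomp Require Import all_classical all_reals all_analysis.
From mathcomp Require Import measurable_realfun.

Set Implicit Arguments.
Unset Strict Implicit.
Unset Printing Implicit Defensive.

Import Order.TTheory GRing.Theory Num.Theory.
Import numFieldNormedType.Exports.

Local Open Scope classical_set_scope.
Local Open Scope ring_scope.

Section product_power.
Context d (X : measurableType d) (R : realType).

Definition tuple_cons n (z : X * n.-tuple X) : n.+1.-tuple X :=
  [the n.+1.-tuple X of z.1 :: z.2].

Lemma measurable_tuple_cons n : measurable_fun [set: X * n.-tuple X] (@tuple_cons n).
Proof. exact: measurable_cons. Qed.

HB.instance Definition _ n :=
  isMeasurableFun.Build _ _ _ _ (@tuple_cons n) (@measurable_tuple_cons n).

Fixpoint power_probability (P : probability X R) (n : nat) :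
    probability (n.-tuple X) R :=
  match n return probability (n.-tuple X) R with
  | 0 => dirac ([tuple] : 0.-tuple X)
  | m.+1 => distribution (P \x power_probability P m)%E (@tuple_cons m)
  end.

Lemma power_probabilityE (P : probability X R) n (A : 'I_n -> set X) :
  (forall i, measurable (A i)) ->
  (power_probability P n [set x | forall i, A i (tnth x i)] =
   \prod_(i < n) P (A i))%E.
Proof.
elim: n A => [|n IHn] A mA.
  rewrite big_ord0 /= diracE mem_set//=; by case.
rewrite big_ord_recl -IHn//= /distribution /pushforward/=.
rewrite -product_measure1E//; last first.
  rewrite (_ : [set x | _] =
      \bigcap_(i in [set: 'I_n]) ((fun x : n.-tuple X => tnth x i)
        @^-1` A (lift ord0 i))); last first.
    apply/seteqP; split => x /= xA; first by move=> i _; exact: xA.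
    by move=> i; exact: (xA i I).
  apply: fin_bigcap_measurable => // i _.
  by rewrite -[X in measurable X]setTI; exact: measurable_tnth.
congr (_ _); apply/seteqP; split => [[a x] /= Aax|[a x] /= [Aa Ax] i].
- split => [|i]; first by have := Aax ord0; rewrite tnth0.
  by have := Aax (lift ord0 i); rewrite tnthS.
- by case: (unliftP ord0 i) => [j|] ->; rewrite ?tnth0 ?tnthS.
Qed.

End product_power.

Section outer_expectation.
Context d (T : measurableType d) (R : realType).
Local Open Scope ereal_scope.

(* The expectation of a test given by a supremum over an uncountable class need
   not exist as an integral; upper bounds are stated for this majorant, which is
   the integral when the test is measurable. *)
Definition outer_expectation (mu : {measure set T -> \bar R}) (f : T -> R) :
    \bar R :=
  ereal_inf [set \int[mu]_x g x | g in
    [set g : T -> \bar R | measurable_fun setT g /\ forall x, (f x)%:E <= g x]].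

Lemma outer_expectationE (mu : {measure set T -> \bar R}) (f : T -> R) :
  measurable_fun setT f -> (forall x, (0 <= f x)%R) ->
  outer_expectation mu f = \int[mu]_x (f x)%:E.
Proof.
move=> mf f0; apply/eqP; rewrite eq_le; apply/andP; split.
- by apply: ereal_inf_lbound; exists (EFin \o f) => //; split => //;
    exact/measurable_EFinP.
- apply: le_ereal_inf_tmp => _ [g [mg fg] <-]; apply: ge0_le_integral => //.
  + by move=> x _; rewrite lee_fin.
  + exact/measurable_EFinP.
Qed.

End outer_expectation.

Section trade_off_functions.
Context d (X : measurableType d) (R : realType).

Definition trade_off (P Q : probability X R) (alpha : R) : \bar R :=
  ereal_inf [set (\int[Q]_x (1 - phi x)%R%:E)%E | phi in
    [set phi : X -> R | [/\ measurable_fun setT phi,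
       forall x, 0 <= phi x <= 1 & (\int[P]_x (phi x)%:E <= alpha%:E)%E]]].

Definition trade_off_ge (P Q : probability X R) (f : R -> R) : Prop :=
  forall alpha, 0 <= alpha <= 1 -> ((f alpha)%:E <= trade_off P Q alpha)%E.

Definition trade_off_nge (P Q : probability X R) (f : R -> R) : Prop :=
  exists2 alpha, 0 <= alpha <= 1 & (trade_off P Q alpha < (f alpha)%:E)%E.

End trade_off_functions.

Definition is_trade_off_function (R : realType) (f : R -> R) : Prop :=
  [/\ convex_function (`[0, 1]%classic : set R^o) f,
      {within `[0, 1]%classic, continuous f},
      {in `[0, 1] &, {homo f : x y / x <= y >-> y <= x}},
      (forall alpha, 0 <= alpha <= 1 -> 0 <= f alpha <= 1 - alpha) &
      forall alpha, 1 < alpha -> f alpha = 0].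

Section VC_dimension.
Local Open Scope card_scope.
Context (X : Type) (R : realType).

Definition shatters (SS : set (set X)) (A : set X) : Prop :=
  exists2 k : nat, A #= `I_k & [set A `&` S | S in SS] #= `I_(2 ^ k).

(* [-oo] for the empty class, which does not even shatter [set0]. *)
Definition VC (SS : set (set X)) : \bar R :=
  ereal_sup [set k%:R%:E | k in
    [set k : nat | exists2 A : set X, A #= `I_k & shatters SS A]].

End VC_dimension.

Section confidence_maps.
Context (R : realType).

Definition vtau (v : \bar R) (n : nat) (delta : R) : R :=
  4 * (fine v * ln (2 * n%:R) + ln (32 / delta)) / n%:R.

Definition vfun (t : R) : R := Num.min t (Num.max (1 - t) 0).

Definition hplus (tau t : R) : R :=
  Num.min (t + Num.sqrt (tau * vfun t) + tau) 1.

Definition hplus_inv (tau t : R) : R :=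
  inf [set s | 0 <= s <= 1 /\ t <= hplus tau s].

End confidence_maps.

Section VC_test.
Context d (X : measurableType d) (R : realType).

Definition empirical n (x : n.-tuple X) (S : set X) : R :=
  n%:R^-1 * \sum_(i < n) \1_S (tnth x i).

Definition psi (SS : set (set X)) (f0 : R -> R) (tau : R) n
    (z : n.-tuple X * n.-tuple X) : R :=
  \1_[set z : n.-tuple X * n.-tuple X | exists2 S, SS S &
        hplus tau (empirical z.2 (~` S)) < f0 (hplus tau (empirical z.1 S))] z.

(* The usual measurability proviso of Vapnik-Chervonenkis theory (compare the
   P-measurable classes of van der Vaart and Wellner): that the class cuts out of
   an i.i.d. sample the points with index in [I] is an event of the completed
   product sigma-algebra. It holds for every countable class. *)
Definition trace_measurable (SS : set (set X)) : Prop :=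
  forall (P : probability X R) (m : nat) (I : set 'I_m),
    completed_algebra_gen (power_probability P m)
      [set x : m.-tuple X | exists2 S, SS S & [set i | S (tnth x i)] = I].

End VC_test.

Section attainability.
Context d (X : measurableType d) (R : realType).
Local Open Scope ereal_scope.
Local Open Scope charge_scope.
Variables P Q : probability X R.

Definition midpoint : set X -> \bar R :=
  mscale (2^-1)%R%:nng%R (measure_add P Q).

HB.instance Definition _ := Measure.on midpoint.

Lemma midpointE A : midpoint A = 2^-1%:E * (P A + Q A).
Proof. by rewrite -measure_addE. Qed.

Lemma midpoint_setT : midpoint setT = 1.
Proof.
rewrite midpointE !probability_setT -EFinD -EFinM.
by rewrite -(natrD _ 1 1) mulVf.
Qed.

HB.instance Definition _ :=
  Measure_isProbability.Build _ _ _ midpoint midpoint_setT.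

Lemma dominates_midpointl : P `<< midpoint.
Proof.
apply/null_content_dominatesP => A mA muA; have /esym/eqP := midpointE A.
rewrite [midpoint A]muA mule_eq0 eqe gt_eqF//= padde_eq0//.
by move=> /andP[/eqP].
Qed.

Lemma dominates_midpointr : Q `<< midpoint.
Proof.
apply/null_content_dominatesP => A mA muA; have /esym/eqP := midpointE A.
rewrite [midpoint A]muA mule_eq0 eqe gt_eqF//= padde_eq0//.
by move=> /andP[_ /eqP].
Qed.

Definition densityP : X -> \bar R :=
  'd (charge_of_finite_measure P) '/d midpoint.

Definition densityQ : X -> \bar R :=
  'd (charge_of_finite_measure Q) '/d midpoint.

Definition lr_region (lambda : \bar R) : set X :=
  if lambda == +oo then [set x | densityP x = 0]
  else [set x | lambda * densityP x < densityQ x].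

Definition attainable (SS : set (set X)) : Prop :=
  forall lambda : \bar R, 0 <= lambda ->
    exists2 S, SS S & {ae midpoint, forall x, \1_S x = \1_(lr_region lambda) x :> R}.

End attainability.

(* Main.v *)
Require Import Defs.
From HB Require Import structures.
From mathcomp Require Import all_boot all_order all_algebra.
From mathcomp Require Import all_classical all_reals all_analysis.
From mathcomp Require Import measurable_realfun.
From mathcomp Require Import zify ring lra.

(** The theorem follows from one event.  Write [p] for the true probability of a
    set and [q] for its frequency in a sample, and let the sample be good when
    [two_sided] holds for every set of the class: [p] and [q] are each at most
    the image of the other by h_+, and so are [1 - p] and [1 - q].

    Type I error.  A rejecting set [S] has
    h_+(Q_n(S^c)) < f0 (h_+(P_n(S))).  If both samples are good, the left side
    is at least Q(S^c) and the right side at most f0(P(S)), since f0 is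
    nonincreasing; but Q(S^c) >= f0(P(S)), because the indicator of [S] is a
    test of level P(S).  So rejection forces one of the samples to be bad.

    Type II error.  If T(P, Q) is somewhere below f1, then some [S] in the class
    has Q(S^c) < f1(P(S)) ([attainable_below_trade_off]): take a supporting line
    of the convex function f1, of slope - lambda; the region {q > lambda p} is
    optimal for the weighted risk defined by this line ([neyman_pearson]).  The
    assumption on f1 gives h_+(h_+(Q(S^c))) < f0(h_+(h_+(P(S)))), and when the
    two samples are good for this one set, monotonicity of h_+ shows that [S]
    rejects.

    It remains to bound the probability of a bad sample ([uniform_deviation]).
    The four inequalities follow from relative deviation bounds such as
    [p - q <= eps * sqrt p], with [eps ^+ 2] equal to tau, for the set and its
    complement ([le_hplus]).  If such a bound fails, some affine function of the
    frequency in an independent ghost sample is at least 1 at the mean of that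
    frequency, and is dominated by an exponential weight that depends only on
    the trace of the set on the double sample ([affine_le_deviation_above],
    [affine_le_deviation_below]).  Hence the indicator of the bad event is at
    most the ghost expectation of the sum of the weights over all traces
    ([symmetrization]).  Exchanging sample and ghost points at random does not
    change the law, and averages each weight down to [expR (- n * tau / 4)] by
    Hoeffding's bound ([signed_average_le]).  The number of traces is at most
    twice the power of [2 * n] with exponent the VC dimension, by the lemma of
    Sauer and Shelah ([card_traces_le]), and the value of tau makes the total at
    most delta. *)

Set Implicit Arguments.
Unset Strict Implicit.
Unset Printing Implicit Defensive.

Import Order.TTheory GRing.Theory Num.Theory.
Import numFieldNormedType.Exports.

Local Open Scope classical_set_scope.
Local Open Scope ring_scope.

(** * The Sauer-Shelah lemma *)

Section sauer_shelah.
Local Open Scope nat_scope.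
Local Open Scope set_scope.
Import mathcomp.boot.finset.
Variable T : finType.
Implicit Types (F : {set {set T}}) (A B S : {set T}).

(** The boolean counterpart, for subsets of a finite type, of the shattering
    relation that defines the VC dimension. *)
Definition fshattered F A := powerset A \subset [set S :&: A | S in F].

Lemma fshatteredP F A :
  reflect (forall B, B \subset A -> exists2 S, S \in F & S :&: A = B)
          (fshattered F A).
Proof.
apply: (iffP fintype.subsetP) => [sh B BA|sh B].
  by have := sh B; rewrite powersetE => /(_ BA)/imsetP[S FS ->]; exists S.
by rewrite powersetE => /sh[S FS <-]; apply/imsetP; exists S.
Qed.

Lemma fshatteredS F F' A : F \subset F' -> fshattered F A -> fshattered F' A.
Proof.
move=> /fintype.subsetP FF' /fshatteredP sh; apply/fshatteredP => B /sh[S FS SA].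
by exists S => //; exact: FF'.
Qed.

(** Pajor's form of the Sauer-Shelah lemma, by induction on the family.  Split
    [F] along a point [x] that some members contain and others avoid.  Both
    halves shatter only sets that avoid [x], and a set [A] shattered by both of
    them accounts for two sets shattered by [F], namely [A] and [x |: A]. *)
Lemma card_le_shattered F : #|F| <= #|[set A | fshattered F A]|.
Proof.
have [m] := ubnP #|F|; elim: m F => // m IH F; rewrite ltnS => Fm.
have [F1|] := leqP #|F| 1.
  have [->|[S FS]] := set_0Vmem F; first by rewrite cards0.
  apply: leq_trans F1 _; rewrite card_gt0; apply/set0Pn; exists set0.
  rewrite inE; apply/fshatteredP => B; rewrite subset0 => /eqP ->.
  by exists S => //; rewrite setI0.
case/card_gt1P => S [S' [FS FS' SS']].
have [x xSS'] : exists x, (x \in S) != (x \in S').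
  apply/existsP; apply: contraNT SS' => /existsPn SS'; apply/eqP/setP => x.
  by have := SS' x; rewrite negbK => /eqP.
pose F0 := [set U in F | x \notin U]; pose F1 := [set U in F | x \in U].
have F0F : F0 \subset F by apply/fintype.subsetP => U; rewrite inE => /andP[].
have F1F : F1 \subset F by apply/fintype.subsetP => U; rewrite inE => /andP[].
have F01 : #|F| = #|F0| + #|F1|.
  rewrite -(cardsID [set U : {set T} | x \in U] F) addnC; congr addn;
    by apply: eq_card => U; rewrite !inE// andbC.
have F0_gt0 : 0 < #|F0|.
  rewrite card_gt0; apply/set0Pn.
  by case xS: (x \in S) xSS'; case xS': (x \in S') => // _;
    [exists S'|exists S]; rewrite inE ?FS ?FS' ?xS ?xS'.
have F1_gt0 : 0 < #|F1|.
  rewrite card_gt0; apply/set0Pn.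
  by case xS: (x \in S) xSS'; case xS': (x \in S') => // _;
    [exists S|exists S']; rewrite inE ?FS ?FS' ?xS ?xS'.
pose s0 := [set A | fshattered F0 A]; pose s1 := [set A | fshattered F1 A].
have s0x A : A \in s0 -> x \notin A.
  rewrite inE => /fshatteredP/(_ A (fintype.subxx A))[V FV VA].
  move: FV; rewrite inE => /andP[_ xV]; apply: contra xV => xA.
  by move: xA; rewrite -{1}VA inE => /andP[].
have s1x A : A \in s1 -> x \notin A.
  rewrite inE => /fshatteredP/(_ set0 (sub0set _))[V FV VA].
  move: FV; rewrite inE => /andP[_ xV]; apply/negP => xA.
  by have : x \in V :&: A by [rewrite inE xV xA]; rewrite VA inE.
have h0 : #|F0| <= #|s0| by apply: IH; apply: leq_trans Fm; rewrite F01 -addn1 leq_add2l.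
have h1 : #|F1| <= #|s1| by apply: IH; apply: leq_trans Fm; rewrite F01 -add1n leq_add2r.
rewrite F01; apply: leq_trans (leq_add h0 h1) _.
rewrite -cardsUI -(card_in_imset (f := fun A => x |: A) (D := s0 :&: s1)); last first.
  move=> A B; rewrite !inE => /andP[A0 _] /andP[B0 _] AB.
  have xA : x \notin A by apply: s0x; rewrite inE.
  have xB : x \notin B by apply: s0x; rewrite inE.
  by rewrite -(setU1K xA) AB setU1K.
set D := [set _ | _ in _].
have s01D : (s0 :|: s1) :&: D = set0.
  apply/setP => A; rewrite inE [RHS]inE.
  apply/negP => /andP[A01 /imsetP[B _ AB]].
  have : x \notin A by move: A01; rewrite in_setU => /orP[/s0x|/s1x].
  by rewrite AB !inE eqxx.
rewrite -[leqLHS]subn0 -(cards0 {set T}) -s01D -cardsU.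
apply/subset_leq_card/fintype.subsetP => A /setUP[/setUP[]|].
- by rewrite !inE; exact: fshatteredS.
- by rewrite !inE; exact: fshatteredS.
move=> /imsetP[B]; rewrite in_setI => /andP[]; rewrite !inE => B0 B1 ->.
have xB : x \notin B by apply: s0x; rewrite inE.
apply/fshatteredP => C CB.
have CxB : C :\ x \subset B by rewrite subDset.
have [xC|xC] := boolP (x \in C).
  have /fshatteredP/(_ _ CxB)[U] := B1.
  rewrite inE => /andP[FU xU] UB; exists U => //.
  by rewrite setIUr UB (setIidPr _) ?sub1set// setD1K.
have /fshatteredP/(_ _ CxB)[U] := B0.
rewrite inE => /andP[FU xU] UB; exists U => //.
rewrite setIUr UB (_ : U :&: [set x] = set0) ?set0U.
  by apply/setP => y; rewrite !inE; have [->|] := eqVneq y x; rewrite ?(negbTE xC).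
by apply/setP => y; rewrite !inE; have [->|] := eqVneq y x; rewrite ?(negbTE xU) ?andbF.
Qed.

Lemma leq_bin_expn N k : 'C(N, k) <= N ^ k.
Proof.
apply: (@leq_trans (N ^_ k)); first by rewrite -bin_ffact leq_pmulr ?fact_gt0.
elim: k => [|k IH]; first by rewrite ffactn0 expn0.
by rewrite ffactnSr expnSr leq_mul// leq_subr.
Qed.

(** The factor 2 pays for the geometric sum of the powers of [N >= 2] that
    dominate the binomial coefficients. *)
Lemma card_subsets_le N k : #|T| = N -> 1 < N ->
  #|[set A : {set T} | #|A| <= k]| <= 2 * N ^ k.
Proof.
move=> cT N1; elim: k => [|k IH].
  rewrite (_ : [set _ | _] = [set set0]) ?cards1 ?expn0//.
  by apply/setP => A; rewrite !inE leqn0 cards_eq0.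
rewrite (_ : [set _ | _] =
    [set A : {set T} | #|A| <= k] :|: [set A : {set T} | #|A| == k.+1]); last first.
  by apply/setP => A; rewrite !inE leq_eqVlt ltnS orbC.
apply: leq_trans (leq_card_setU _ _) _.
rewrite card_draws cT; apply: leq_trans (leq_add IH (leq_bin_expn _ _)) _.
rewrite expnS [leqRHS]mul2n -addnn leq_add2r.
by rewrite leq_mul2r N1 orbT.
Qed.

Lemma sauer_shelah F k : 1 < #|T| ->
  (forall A, fshattered F A -> #|A| <= k) -> #|F| <= 2 * #|T| ^ k.
Proof.
move=> T1 Fk; apply: leq_trans (card_le_shattered F) _.
apply: leq_trans (card_subsets_le k erefl T1).
by apply/subset_leq_card/fintype.subsetP => A; rewrite !inE; exact: Fk.
Qed.

End sauer_shelah.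

(** * Exponential weights of relative deviations *)

Section subgaussian_signs.
Variable R : realType.
Implicit Types x c : R.

Lemma ge0_derive_ge0 (f f' : R -> R) : (forall x, is_derive x 1 f (f' x)) ->
  (forall x, 0 < x -> 0 <= f' x) -> forall x, 0 <= x -> f 0 <= f x.
Proof.
move=> df f'0 x x0; apply: (@ger0_derive1_ndecr _ f 0 x) => //.
- by move=> y; rewrite in_itv/= => /andP[y0 _];
  rewrite derive1E (@derive_val _ _ _ _ _ _ _ (df y)) f'0.
- by apply: derivable_within_continuous => y _; exact: ex_derive.
Qed.

Lemma expRB_le_xexpRD x : 0 <= x -> expR x - expR (- x) <= x * (expR x + expR (- x)).
Proof.
move=> x0; rewrite -subr_ge0.
pose f (y : R) := y * (expR y + expR (- y)) - (expR y - expR (- y)).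
have <- : f 0 = 0 by rewrite /f mul0r oppr0 subrr subr0.
apply: (@ge0_derive_ge0 f (fun y => y * (expR y - expR (- y)))) => // y.
  by apply: is_derive_eq; rewrite /GRing.scale/=; ring.
by move=> y0; rewrite mulr_ge0 ?(ltW y0)// subr_ge0 ler_expR; lra.
Qed.

(** The function [2 * cosh x * expR (- x ^+ 2 / 2)] is nonincreasing on the
    nonnegative reals, since its derivative has the sign of [tanh x - x]. *)
Lemma expRD_expRN_le x : expR x + expR (- x) <= 2 * expR (x ^+ 2 / 2).
Proof.
wlog x0 : x / 0 <= x => [h|].
  have [x0|x0] := leP 0 x; first exact: h.
  by have := h (- x); rewrite opprK sqrrN addrC; apply; rewrite oppr_ge0 ltW.
rewrite -ler_pdivrMr ?expR_gt0// -expRN.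
pose f (y : R) := - ((expR y + expR (- y)) * expR (- (y ^+ 2 / 2))).
suff : f 0 <= f x.
  by rewrite /f lerN2 oppr0 expR0 expr0n mul0r oppr0 expR0 mulr1.
apply: (@ge0_derive_ge0 f (fun y => (y * (expR y + expR (- y)) -
   (expR y - expR (- y))) * expR (- (y ^+ 2 / 2)))) => // y.
  by apply: is_derive_eq; rewrite /GRing.scale/=; field.
by move=> y0; rewrite mulr_ge0 ?expR_ge0// subr_ge0 expRB_le_xexpRD// ltW.
Qed.

(** Hoeffding's bound for a Rademacher sum: the sum over all sign patterns
    factorizes, and each factor is subgaussian. *)
Lemma sum_signs_expR_le n (d : 'I_n -> R) c :
  \sum_(s : {ffun 'I_n -> bool}) expR (c * \sum_(i < n) (-1) ^+ s i * d i) <=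
  2 ^+ n * expR (c ^+ 2 / 2 * \sum_(i < n) d i ^+ 2).
Proof.
under eq_bigr do rewrite mulr_sumr expR_sum.
rewrite -(bigA_distr_bigA (fun i (b : bool) => expR (c * ((-1) ^+ b * d i))))/=.
have -> : 2 ^+ n = \prod_(i < n) 2 :> R by rewrite prodr_const card_ord.
rewrite mulr_sumr expR_sum -big_split/=.
apply: ler_prod => i _; rewrite big_bool/= expr0 expr1 mul1r mulN1r mulrN addrC.
rewrite addr_ge0 ?expR_ge0//=; apply: le_trans (expRD_expRN_le _) _.
by rewrite exprMn mulrAC.
Qed.

End subgaussian_signs.

Section deviation_weight.
Variable R : realType.
Implicit Types (eps k a b p : R).

(** The exponential of the relative deviation [(a - b) / sqrt ((a + b) / 2)] of
    two frequencies.  It does not involve the true probability, so that it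
    can be summed over the traces of a class of sets.  The exponent is [- k] when both frequencies vanish. *)
Definition deviation_weight eps k a b : R :=
  expR (k * ((a - b) / (eps * Num.sqrt ((a + b) / 2)) - 1)).

Lemma deviation_weight_ge0 eps k a b : 0 <= deviation_weight eps k a b.
Proof. exact: expR_ge0. Qed.

(** Here [b] will be the frequency in a ghost sample, whose mean [p] satisfies
    [eps * sqrt a <= a - p].  The left side is affine in [b] and at least 1 at
    [b = p]; it is below the weight because [1 + u <= expR u] and because
    [(a + b) / 2 <= a] when [b <= a]. *)
Lemma affine_le_deviation_below eps k a b : 0 < eps -> 1 <= k ->
    0 < a -> 0 <= b ->
  1 + k * ((a - b) / (eps * Num.sqrt a) - 1) <= deviation_weight eps k a b.
Proof.
move=> e0 k1 a0 b0; rewrite /deviation_weight.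
have k0 : 0 < k by lra.
have sa0 : 0 < Num.sqrt a by rewrite sqrtr_gt0.
have [ba|ab] := leP b a; last first.
  apply: le_trans (expR_ge0 _).
  have : (a - b) / (eps * Num.sqrt a) <= 0.
    by rewrite mulr_le0_ge0 ?invr_ge0 ?mulr_ge0 ?sqrtr_ge0//; lra.
  nra.
apply: le_trans (expR_ge1Dx _).
rewrite lerD2l ler_pM2l// lerD2r ler_wpM2l ?subr_ge0//.
rewrite lef_pV2 ?posrE ?mulr_gt0 ?sqrtr_gt0//; last by lra.
by rewrite ler_pM2l// ler_sqrt; lra.
Qed.

(** Here [a] will be the frequency in a ghost sample, with mean [p].  The left
    side is affine in [a] and at least 1 at [a = p].  With [m := (a + b) / 2],
    [1 + u <= expR u] still suffices when [m <= p]; when [m > p] the hypothesis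
    on [b] makes [(a - b) / (eps * sqrt p)] at most half the square of
    [(a - b) / (eps * sqrt m)], which a second-order lower bound of [expR]
    absorbs. *)
Lemma affine_le_deviation_above eps k p a b : 0 < eps -> 2 <= k ->
    0 < p -> 0 <= a -> 0 <= b -> eps * Num.sqrt p <= p - b ->
  1 + k * ((a - b) / (eps * Num.sqrt p) - 1) <= deviation_weight eps k a b.
Proof.
move=> e0 k2 p0 a0 b0 ep; rewrite /deviation_weight.
have k0 : 0 < k by lra.
have sp0 : 0 < Num.sqrt p by rewrite sqrtr_gt0.
have esp0 : 0 < eps * Num.sqrt p by rewrite mulr_gt0.
have [ba|ab] := ltP b a; last first.
  apply: le_trans (expR_ge0 _).
  have : (a - b) / (eps * Num.sqrt p) <= 0.
    by rewrite mulr_le0_ge0 ?invr_ge0 ?(ltW esp0)//; lra.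
  nra.
set m := (a + b) / 2.
have m0 : 0 < m by rewrite /m; lra.
have sm0 : 0 < Num.sqrt m by rewrite sqrtr_gt0.
have esm0 : 0 < eps * Num.sqrt m by rewrite mulr_gt0.
have [mp|pm] := leP m p.
  apply: le_trans (expR_ge1Dx _).
  rewrite lerD2l ler_pM2l// lerD2r ler_wpM2l ?subr_ge0 ?(ltW ba)//.
  by rewrite lef_pV2 ?posrE// ler_pM2l// ler_sqrt// ltW.
set z := (a - b) / (eps * Num.sqrt m); set y := (a - b) / (eps * Num.sqrt p).
have ppE : Num.sqrt p ^+ 2 = p by rewrite sqr_sqrtr// ltW.
have mmE : Num.sqrt m ^+ 2 = m by rewrite sqr_sqrtr// ltW.
have abm : a - b = 2 * (m - b) by rewrite /m; field.
have ab2 : 2 * (m - p + eps * Num.sqrt p) <= a - b by rewrite abm; lra.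
have ep' : eps <= Num.sqrt p.
  by rewrite -(ler_pM2r sp0) -[leRHS]expr2 ppE; lra.
have y2 : 2 <= y by rewrite /y ler_pdivlMr//; lra.
(* by the lower bound on a - b, this amounts to 0 <= (m - p) * (sqrt p - eps) *)
have yz : y <= z ^+ 2 / 2.
  rewrite /y /z exprMn exprVn exprMn mmE ler_pdivrMr//.
  rewrite [leRHS](_ : _ = (a - b) * ((a - b) * (Num.sqrt p / (2 * eps * m)))); last first.
    by field; rewrite !gt_eqF.
  apply: ler_peMr; first by lra.
  have em0 : 0 < 2 * eps * m by apply: mulr_gt0 => //; exact: mulr_gt0.
  rewrite mulrA ler_pdivlMr// mul1r.
  have : 0 <= (m - p) * (Num.sqrt p - eps) by rewrite mulr_ge0//; lra.
  have : 2 * (m - p + eps * Num.sqrt p) * Num.sqrt p <= (a - b) * Num.sqrt p.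
    by rewrite ler_pM2r.
  have -> : 2 * (m - p + eps * Num.sqrt p) * Num.sqrt p =
    2 * (m - p) * Num.sqrt p + 2 * eps * (Num.sqrt p ^+ 2) by ring.
  rewrite ppE; nra.
have z0 : 0 <= z by rewrite /z divr_ge0 ?ltW// subr_gt0.
have z2 : 2 <= z by rewrite -(@ler_pXn2r _ 2%N) ?nnegrE//; lra.
have kz : 0 <= k * (z - 1) by rewrite mulr_ge0//; lra.
(* expR u is at least the square of 1 + u / 2; 2 <= k then turns k ^+ 2 / 4 into k / 2 *)
apply: (@le_trans _ _ ((1 + k * (z - 1) / 2) ^+ 2)); last first.
  have -> : expR (k * (z - 1)) = expR (k * (z - 1) / 2) ^+ 2.
    by rewrite -expRM_natr; congr expR; field.
  rewrite ler_pXn2r ?nnegrE ?expR_ge0 ?expR_ge1Dx//.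
  by rewrite addr_ge0// divr_ge0.
have : k * (y - 1) <= k * (z - 1) + k * (z - 1) ^+ 2 / 2.
  rewrite -mulrA -mulrDr ler_pM2l//.
  suff -> : z - 1 + (z - 1) ^+ 2 / 2 = z ^+ 2 / 2 - 1 / 2 by lra.
  by field.
have : 2 * k * (z - 1) ^+ 2 <= k ^+ 2 * (z - 1) ^+ 2.
  by rewrite ler_wpM2r ?sqr_ge0// expr2 ler_wpM2r// ltW.
nra.
Qed.

End deviation_weight.

(** * Exchanging sample and ghost sample *)

Section swaps.
Variables (R : realType) (n : nat).
Implicit Types (s : {ffun 'I_n -> bool}) (I : {set 'I_(n + n)}).

(** Index [lshift n i] is the i-th point of the sample and [rshift n i] the
    i-th point of the ghost sample; [s] exchanges the two for the [i] with
    [s i]. *)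
Definition swap_halves s (j : 'I_(n + n)) : 'I_(n + n) :=
  match fintype.split j with
  | inl i => if s i then rshift n i else lshift n i
  | inr i => if s i then lshift n i else rshift n i
  end.

Lemma swap_lshift s i : swap_halves s (lshift n i) = if s i then rshift n i else lshift n i.
Proof. by rewrite /swap_halves (unsplitK (inl i)). Qed.

Lemma swap_rshift s i : swap_halves s (rshift n i) = if s i then lshift n i else rshift n i.
Proof. by rewrite /swap_halves (unsplitK (inr i)). Qed.

Lemma swap_halvesK s : involutive (swap_halves s).
Proof.
move=> j; case: (fintype.splitP j) => i ji.
  have -> : j = lshift n i by exact: val_inj.
  by rewrite swap_lshift; case: ifPn => si;
    rewrite ?swap_lshift ?swap_rshift ?(negbTE si) ?si.
have -> : j = rshift n i by exact: val_inj.
by rewrite swap_rshift; case: ifPn => si;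
  rewrite ?swap_lshift ?swap_rshift ?(negbTE si) ?si.
Qed.

Definition lfreq I : R := n%:R^-1 * \sum_(i < n) (lshift n i \in I)%:R.
Definition rfreq I : R := n%:R^-1 * \sum_(i < n) (rshift n i \in I)%:R.

Lemma lrfreq_swapB s I :
  lfreq (swap_halves s @^-1: I) - rfreq (swap_halves s @^-1: I) =
  n%:R^-1 * \sum_(i < n) (-1) ^+ s i *
    ((lshift n i \in I)%:R - (rshift n i \in I)%:R).
Proof.
rewrite -mulrBr -sumrB; congr (_ * _); apply: eq_bigr => i _.
rewrite !inE swap_lshift swap_rshift; case: (s i); rewrite ?expr1 ?expr0; ring.
Qed.

Lemma lrfreq_swapD s I :
  lfreq (swap_halves s @^-1: I) + rfreq (swap_halves s @^-1: I) = lfreq I + rfreq I.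
Proof.
rewrite -!mulrDr -!big_split/=; congr (_ * _); apply: eq_bigr => i _.
by rewrite !inE swap_lshift swap_rshift; case: (s i) => //; rewrite addrC.
Qed.

(** The variance proxy [\sum_i d i ^+ 2] of the signed sum is at most the
    normalization [\sum_i u i] that appears under the square root, so that the
    exponent [k / 2] of the subgaussian bound is half of the [k] subtracted. *)
Lemma signed_average_le (eps : R) (d u : 'I_n -> R) : 0 < eps -> (0 < n)%N ->
  (forall i, d i ^+ 2 <= u i) ->
  let k := n%:R * eps ^+ 2 / 2 in
  \sum_(s : {ffun 'I_n -> bool}) expR (k * ((n%:R^-1 * \sum_(i < n) (-1) ^+ s i * d i) /
      (eps * Num.sqrt ((n%:R^-1 * \sum_(i < n) u i) / 2)) - 1)) <=
  2 ^+ n * expR (- (n%:R * eps ^+ 2 / 4)).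
Proof.
move=> e0 n0 du; set k := n%:R * eps ^+ 2 / 2 => /=.
have n0' : 0 < n%:R :> R by rewrite ltr0n.
pose m := n%:R^-1 * (\sum_(i < n) u i) / 2; rewrite -/m.
have m0 : 0 <= m.
  rewrite /m divr_ge0// mulr_ge0 ?invr_ge0// sumr_ge0// => i _.
  exact: le_trans (sqr_ge0 _) (du i).
pose c := eps / 2 / Num.sqrt m.
rewrite [leLHS](_ : _ = \sum_(s : {ffun 'I_n -> bool})
    expR (c * \sum_(i < n) (-1) ^+ s i * d i) * expR (- k)).
  rewrite -mulr_suml; apply: (le_trans (ler_wpM2r (expR_ge0 _) (sum_signs_expR_le _ _))).
  rewrite -[leLHS]mulrA; apply: ler_wpM2l; first exact: exprn_ge0.
  rewrite -expRD ler_expR /k.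
  have Hd : c ^+ 2 / 2 * \sum_(i < n) d i ^+ 2 <= c ^+ 2 / 2 * \sum_(i < n) u i.
    by rewrite ler_wpM2l ?divr_ge0 ?sqr_ge0//; exact: ler_sum.
  have uE : \sum_(i < n) u i = 2 * n%:R * m by rewrite /m; field; rewrite gt_eqF.
  suff : c ^+ 2 / 2 * \sum_(i < n) u i <= n%:R * eps ^+ 2 / 4 by lra.
  rewrite uE /c; have [mz|mnz] := eqVneq m 0.
    rewrite mz !mulr0; apply: divr_ge0 => //; apply: mulr_ge0; [exact: ltW|exact: sqr_ge0].
  rewrite exprMn exprVn sqr_sqrtr// le_eqVlt; apply/orP; left; apply/eqP.
  by field.
apply: eq_bigr => s _; rewrite -expRD /k /c; congr expR.
set D := \sum_(i < n) _.
have [->|smnz] := eqVneq (Num.sqrt m) 0; first by rewrite mulr0 !invr0; ring.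
by field; rewrite smnz !gt_eqF.
Qed.

Lemma deviation_weight_swap_lr (eps : R) I : 0 < eps -> (0 < n)%N ->
  \sum_s deviation_weight eps (n%:R * eps ^+ 2 / 2)
     (lfreq (swap_halves s @^-1: I)) (rfreq (swap_halves s @^-1: I)) <=
  2 ^+ n * expR (- (n%:R * eps ^+ 2 / 4)).
Proof.
move=> e0 n0.
pose d i : R := (lshift n i \in I)%:R - (rshift n i \in I)%:R.
pose u i : R := (lshift n i \in I)%:R + (rshift n i \in I)%:R.
have du i : d i ^+ 2 <= u i.
  by rewrite /d /u; case: (_ \in _); case: (_ \in _) => /=; lra.
apply: le_trans (signed_average_le e0 n0 du).
rewrite le_eqVlt; apply/orP; left; apply/eqP; apply: eq_bigr => s _.
rewrite /deviation_weight lrfreq_swapB lrfreq_swapD.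
by rewrite -mulrDr -big_split.
Qed.

Lemma deviation_weight_swap_rl (eps : R) I : 0 < eps -> (0 < n)%N ->
  \sum_s deviation_weight eps (n%:R * eps ^+ 2 / 2)
     (rfreq (swap_halves s @^-1: I)) (lfreq (swap_halves s @^-1: I)) <=
  2 ^+ n * expR (- (n%:R * eps ^+ 2 / 4)).
Proof.
move=> e0 n0.
pose d i : R := (rshift n i \in I)%:R - (lshift n i \in I)%:R.
pose u i : R := (lshift n i \in I)%:R + (rshift n i \in I)%:R.
have du i : d i ^+ 2 <= u i.
  by rewrite /d /u; case: (_ \in _); case: (_ \in _) => /=; lra.
apply: le_trans (signed_average_le e0 n0 du).
rewrite le_eqVlt; apply/orP; left; apply/eqP; apply: eq_bigr => s _.
set J := swap_halves s @^-1: I.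
have E1 : rfreq J - lfreq J = n%:R^-1 * \sum_(i < n) (-1) ^+ s i * d i.
  rewrite -[LHS]opprB /J lrfreq_swapB -mulrN -sumrN; congr (_ * _).
  by apply: eq_bigr => i _; rewrite -mulrN opprB.
have E2 : rfreq J + lfreq J = n%:R^-1 * \sum_(i < n) u i.
  by rewrite /J addrC lrfreq_swapD -mulrDr -big_split.
by rewrite /deviation_weight E1 E2.
Qed.

End swaps.

(** * Powers of a probability *)

Section power_probability_theory.
Context d (X : measurableType d) (R : realType).
Implicit Types (P : probability X R).

Definition rectangle m (A : 'I_m -> set X) : set (m.-tuple X) :=
  [set x | forall i, A i (tnth x i)].

Lemma measurable_rectangle m (A : 'I_m -> set X) :
  (forall i, measurable (A i)) -> measurable (rectangle A).
Proof.
move=> mA; rewrite (_ : rectangle A =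
    \bigcap_(i in [set: 'I_m]) ((fun x : m.-tuple X => tnth x i) @^-1` A i)).
  apply: fin_bigcap_measurable => // i _.
  by rewrite -[X in measurable X]setTI; exact: measurable_tnth.
by apply/seteqP; split => x /= xA i; [move=> _; exact: xA|exact: (xA i I)].
Qed.

Lemma power_probability_rectangle P m (A : 'I_m -> set X) :
  (forall i, measurable (A i)) ->
  power_probability P m (rectangle A) = (\prod_(i < m) P (A i))%E.
Proof. exact: power_probabilityE. Qed.

(** Rectangles are stable under intersection and generate the product
    sigma-algebra of tuples. *)
Lemma power_probability_unique P m (mu : probability (m.-tuple X) R) :
  (forall A, (forall i, measurable (A i)) ->
     mu (rectangle A) = (\prod_(i < m) P (A i))%E) ->
  forall B, measurable B -> mu B = power_probability P m B.
Proof.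
move=> muA B mB.
pose G := [set B | exists2 A : 'I_m -> set X,
  (forall i, measurable (A i)) & B = rectangle A].
apply: (@measure_unique _ R _ G (fun=> setT)) => //.
- apply/seteqP; split; last first.
    apply: smallest_sub; first exact: sigma_algebra_measurable.
    by move=> _ [A mA ->]; exact: measurable_rectangle.
  apply: smallest_sub; first exact: smallest_sigma_algebra.
  move=> C; rewrite -bigcup_seq/= => -[i _ [D mD <-]].
  apply: sub_sigma_algebra.
  exists (fun j => if j == i then D else setT); first by move=> j; case: ifP.
  rewrite setTI; apply/seteqP; split => x /= xD; last by have := xD i; rewrite eqxx.
  by move=> j; case: ifPn => // /eqP ->.
- move=> _ _ [A mA ->] [A' mA' ->]; exists (fun i => A i `&` A' i).
    by move=> i; exact: measurableI.
  by apply/seteqP; split => x /=; [move=> [xA xA'] i|move=> xA; split=> i; case: (xA i)].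
- move=> _; exists (fun=> setT) => //.
  by apply/seteqP; split.
- by rewrite bigcup_const.
- by move=> _ [A mA ->]; apply: etrans (muA _ mA) _; exact/esym/power_probability_rectangle.
- by move=> _; rewrite [ltLHS](probability_setT mu) ltry.
Qed.

Definition cat_pair n (z : n.-tuple X * n.-tuple X) : (n + n).-tuple X :=
  [tuple of z.1 ++ z.2].

Lemma tnth_cat_pair_l n (z : n.-tuple X * n.-tuple X) i :
  tnth (cat_pair z) (lshift n i) = tnth z.1 i.
Proof. by rewrite /cat_pair tnth_lshift. Qed.

Lemma tnth_cat_pair_r n (z : n.-tuple X * n.-tuple X) i :
  tnth (cat_pair z) (rshift n i) = tnth z.2 i.
Proof. by rewrite /cat_pair tnth_rshift. Qed.

Lemma measurable_cat_pair n : measurable_fun setT (@cat_pair n).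
Proof.
apply/measurable_fun_tnthP => j; case: (fintype.splitP j) => i ji.
  have -> : j = lshift n i by exact: val_inj.
  rewrite (_ : _ \o _ = (@tnth n X ^~ i) \o fst).
    by apply: measurableT_comp => //; exact: measurable_tnth.
  by apply/funext => z /=; rewrite tnth_cat_pair_l.
have -> : j = rshift n i by exact: val_inj.
rewrite (_ : _ \o _ = (@tnth n X ^~ i) \o snd).
  by apply: measurableT_comp => //; exact: measurable_tnth.
by apply/funext => z /=; rewrite tnth_cat_pair_r.
Qed.

HB.instance Definition _ n :=
  isMeasurableFun.Build _ _ _ _ (@cat_pair n) (@measurable_cat_pair n).

Lemma distribution_cat_pair P n B : measurable B ->
  distribution (power_probability P n \x power_probability P n)%E (@cat_pair n) B =
  power_probability P (n + n) B.
Proof.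
apply: power_probability_unique => A mA; rewrite /distribution /pushforward/=.
rewrite (_ : _ @^-1` _ = rectangle (fun i => A (lshift n i)) `*`
    rectangle (fun i => A (rshift n i))); last first.
  apply/seteqP; split => z /=.
    move=> zA; split => i /=.
      by have := zA (lshift n i); rewrite tnth_cat_pair_l.
    by have := zA (rshift n i); rewrite tnth_cat_pair_r.
  move=> [zl zr] j; case: (fintype.splitP j) => i ji.
    have -> : j = lshift n i by exact: val_inj.
    by rewrite tnth_cat_pair_l; exact: zl.
  have -> : j = rshift n i by exact: val_inj.
  by rewrite tnth_cat_pair_r; exact: zr.
rewrite product_measure1E; try exact: measurable_rectangle.
by rewrite big_split_ord/=; congr (_ * _)%E; exact: power_probability_rectangle.
Qed.

Definition reindex_tuple m (s : 'I_m -> 'I_m) (z : m.-tuple X) : m.-tuple X :=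
  [tuple tnth z (s i) | i < m].

Lemma measurable_reindex_tuple m (s : 'I_m -> 'I_m) :
  measurable_fun setT (reindex_tuple s).
Proof.
apply/measurable_fun_tnthP => j.
rewrite (_ : _ \o _ = (@tnth m X ^~ (s j))); first exact: measurable_tnth.
by apply/funext => z /=; rewrite tnth_mktuple.
Qed.

HB.instance Definition _ m s :=
  isMeasurableFun.Build _ _ _ _ (@reindex_tuple m s) (@measurable_reindex_tuple m s).

Lemma distribution_reindex_tuple P m (s : 'I_m -> 'I_m) B :
  involutive s -> measurable B ->
  distribution (power_probability P m) (reindex_tuple s) B = power_probability P m B.
Proof.
move=> sK; apply: power_probability_unique => A mA.
rewrite [LHS](_ : _ = power_probability P m (reindex_tuple s @^-1` rectangle A))//.
rewrite (_ : _ @^-1` _ = rectangle (fun i => A (s i))); last first.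
  apply/seteqP; split => z /= zA i.
    by have := zA (s i); rewrite tnth_mktuple sK.
  by rewrite tnth_mktuple; have := zA (s i); rewrite sK.
rewrite [RHS](reindex_inj (inv_inj sK)).
exact: power_probability_rectangle.
Qed.

End power_probability_theory.

(** * Traces of a class and symmetrization *)

Section traces.
Context d (X : measurableType d).
Implicit Types (S : set X) (SS : set (set X)).

Definition trace m S (z : m.-tuple X) : {set 'I_m} :=
  [set i | `[< S (tnth z i) >]]%SET.

Definition traces m SS (z : m.-tuple X) : {set {set 'I_m}} :=
  [set I | `[< exists2 S, SS S & trace S z = I >]]%SET.

Lemma traceP m S (z : m.-tuple X) i : reflect (S (tnth z i)) (i \in trace S z).
Proof. by rewrite inE; exact: asboolP. Qed.

Lemma mem_traces m SS S (z : m.-tuple X) : SS S -> trace S z \in traces SS z.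
Proof. by move=> SS_S; rewrite inE; apply/asboolP; exists S. Qed.

Lemma trace_set m S (z : m.-tuple X) :
  [set i | S (tnth z i)] = [set` trace S z].
Proof. by apply/seteqP; split => i /=; [move/traceP|move/traceP]. Qed.

Lemma traceC m S (z : m.-tuple X) : trace (~` S) z = finset.setC (trace S z).
Proof. by apply/setP => i; rewrite !inE asbool_neg. Qed.

Lemma trace_reindex m S (z : m.-tuple X) (s : 'I_m -> 'I_m) :
  trace S (reindex_tuple s z) = (s @^-1: trace S z)%SET.
Proof. by apply/setP => i; rewrite !inE tnth_mktuple. Qed.

(** The trace takes finitely many values, each of them on a rectangle. *)
Lemma measurable_trace_fun m S (R : realType) (w : {set 'I_m} -> R) :
  measurable S -> measurable_fun setT (fun z : m.-tuple X => w (trace S z)).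
Proof.
move=> mS; pose E I := [set z : m.-tuple X | trace S z = I].
have mE I : measurable (E I).
  rewrite (_ : E I = rectangle (fun i => if i \in I then S else ~` S)).
    by apply: measurable_rectangle => i; case: ifP => // _; exact: measurableC.
  apply/seteqP; split => z /=.
    by move=> <- i; case: ifPn => /traceP.
  move=> zI; apply/setP => i; have := zI i; case: ifPn => iI.
    by move=> /traceP ->.
  by move=> Si; apply/negbTE/traceP.
rewrite (_ : (fun _ => _) = fun z => \sum_I w I * \1_(E I) z).
  apply: measurable_sum => I.
  by apply: measurable_funM => //; exact: measurable_indic.
apply/funext => z; rewrite (bigD1 (trace S z))//= indicE mem_set// mulr1.
rewrite big1 ?addr0// => I IS; rewrite indicE memNset ?mulr0// /E/=.
by move=> SI; rewrite SI eqxx in IS.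
Qed.

End traces.

Section symmetrization.
Context d (X : measurableType d) (R : realType).
Variables (P : probability X R) (n : nat) (SS : set (set X)).
Hypothesis mSS : SS `<=` measurable.
Hypothesis tSS : trace_measurable R SS.
Local Notation mu := (power_probability P (n + n)).
Implicit Types (I : {set 'I_(n + n)}).

Let shows I := [set z : (n + n).-tuple X | exists2 S, SS S & trace S z = I].

(** The event that the class cuts out the trace [I] lies between [AN.1] and
    [AN.1 `|` AN.2], two measurable sets of the same probability. *)
Let exists_cover I : exists AN : set ((n + n).-tuple X) * set ((n + n).-tuple X),
  [/\ measurable AN.1, measurable AN.2, mu AN.2 = 0,
      AN.1 `<=` shows I & shows I `<=` AN.1 `|` AN.2].
Proof.
have [A mA [N [B [mB B0 NB]] ANI]] := @tSS P (n + n) [set` I].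
have showsE : shows I = A `|` N.
  rewrite ANI; apply/seteqP; split => z [S SS_S SI]; exists S => //.
    by rewrite trace_set SI.
  by move: SI; rewrite trace_set => /seteqP[h1 h2]; apply/setP => i;
    apply/idP/idP; [exact: h1|exact: h2].
exists (A, B); split => //=; rewrite showsE; first exact: subsetUl.
exact: setUS.
Qed.

Let sure I := (sval (cid (exists_cover I))).1.
Let null I := (sval (cid (exists_cover I))).2.

Let coverP I : [/\ measurable (sure I), measurable (null I), mu (null I) = 0,
  sure I `<=` shows I & shows I `<=` sure I `|` null I].
Proof. exact: svalP (cid (exists_cover I)). Qed.

Let freq I := fine (mu (sure I)).

Let freqE I : (freq I)%:E = mu (sure I).
Proof. by rewrite fineK// fin_num_measure//; have [] := coverP I. Qed.

Let freq_ge0 I : 0 <= freq I.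
Proof. by rewrite fine_ge0. Qed.

Let mu_cover I : mu (sure I `|` null I) = (freq I)%:E.
Proof.
have [mA mN N0 _ _] := coverP I; rewrite freqE.
apply/eqP; rewrite eq_le; apply/andP; split.
  have : (mu (sure I `|` null I) <= mu (sure I) + mu (null I))%E by exact: measureU2.
  by rewrite N0 adde0.
by apply: le_measure => //; rewrite ?inE//; exact: measurableU.
Qed.

(** Exchangeability: swapping maps the event of one trace to that of another,
    and the inner set has the least probability among measurable covers. *)
Let freq_swap s I : freq (swap_halves s @^-1: I)%SET <= freq I.
Proof.
have [mA _ _ Ashows _] := coverP (swap_halves s @^-1: I)%SET.
have [mA' mN' _ _ sub] := coverP I.
have mAN : measurable (sure I `|` null I) by exact: measurableU.
rewrite -lee_fin freqE -mu_cover.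
rewrite -(distribution_reindex_tuple P (swap_halvesK s) mAN).
rewrite [leRHS](_ : _ = mu (reindex_tuple (swap_halves s) @^-1` (sure I `|` null I)))//.
have mr := @measurable_reindex_tuple _ X _ (swap_halves s).
apply: le_measure; rewrite ?inE//.
  by rewrite -[X in measurable X]setTI; exact: mr.
move=> z /Ashows[S SS_S SI]; apply: sub; exists S => //.
by rewrite trace_reindex SI; apply/setP => i; rewrite !inE swap_halvesK.
Qed.

(** The probabilities add up to the expected number of traces.  This step needs
    the events themselves to be measurable up to null sets: outer probabilities
    of nonmeasurable events could add up to more. *)
Let sum_freq_le K : (forall z : (n + n).-tuple X, #|traces SS z|%:R <= K) ->
  \sum_I freq I <= K.
Proof.
move=> tK; rewrite -lee_fin -sumEFin.
have freqI I : (freq I)%:E = (\int[mu]_z (\1_(sure I) z)%:E)%E.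
  by rewrite integral_indic// ?setIT ?freqE//; have [] := coverP I.
rewrite (eq_bigr _ (fun I _ => freqI I)).
rewrite -ge0_integral_sum//; last first.
  by move=> I; apply/measurable_EFinP/measurable_indic; have [] := coverP I.
rewrite -[leRHS]mule1 -(probability_setT mu) -(integral_cst mu measurableT).
apply: ge0_le_integral => //.
- by move=> z _; apply: sume_ge0 => I _; rewrite lee_fin.
- apply: emeasurable_sum => I; apply/measurable_EFinP/measurable_indic.
  by have [] := coverP I.
move=> z _; rewrite sumEFin lee_fin; apply: le_trans (tK z).
rewrite -sum1_card natr_sum [leRHS]big_mkcond/=.
apply: ler_sum => I _; rewrite indicE.
case: (boolP (z \in sure I)) => [|_]; last by case: ifP.
rewrite inE => zI; have [_ _ _ /(_ z zI)[S SS_S <-] _] := coverP I.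
by rewrite mem_traces.
Qed.

(** If every bad sample has a set in the class whose weight is at least 1 on
    average over a ghost sample, then the sum of the weights over all traces of
    the class on the double sample dominates the bad event after integration of
    the ghost sample.  By exchangeability each weight may be replaced by its
    average over the swaps.  [g] is a measurable majorant because the bad event,
    a union over an arbitrary class, may fail to be measurable. *)
Lemma symmetrization (K rho : R) (w : {set 'I_(n + n)} -> R)
    (bad : set (n.-tuple X)) :
  0 <= rho ->
  (forall z : (n + n).-tuple X, #|traces SS z|%:R <= K) ->
  (forall I, 0 <= w I) ->
  (forall I, \sum_(s : {ffun 'I_n -> bool}) w (swap_halves s @^-1: I)%SET <=
     2 ^+ n * rho) ->
  (forall x, bad x -> exists2 S, SS S &
     (1 <= \int[power_probability P n]_y (w (trace S (cat_pair (x, y))))%:E)%E) ->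
  exists g : n.-tuple X -> \bar R, [/\ measurable_fun setT g,
    forall x, (0 <= g x)%E, forall x, bad x -> (1 <= g x)%E &
    (\int[power_probability P n]_x g x <= (K * rho)%:E)%E].
Proof.
move=> rho0 tK w0 wrho badP.
pose cov I := sure I `|` null I.
have mcov I : measurable (cov I) by have [mA mN _ _ _] := coverP I; exact: measurableU.
pose W (z : (n + n).-tuple X) := (\sum_I (w I)%:E * (\1_(cov I) z)%:E)%E.
have mW1 I : measurable_fun setT (fun z => (w I)%:E * (\1_(cov I) z)%:E)%E.
  by apply: measurable_funeM; apply/measurable_EFinP/measurable_indic.
have mW : measurable_fun setT W by exact: emeasurable_sum.
have W0 z : (0 <= W z)%E.
  by apply: sume_ge0 => I _; rewrite mule_ge0// lee_fin.
have mWc : measurable_fun setT (W \o @cat_pair _ X n).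
  by apply: measurableT_comp => //; exact: measurable_cat_pair.
exists (fubini_F (power_probability P n) (W \o @cat_pair _ X n)); split.
- by apply: measurable_fun_fubini_tonelli_F => // z; exact: W0.
- by move=> x; apply: integral_ge0 => y _; exact: W0.
- move=> x /badP[S SS_S]; move=> /le_trans; apply.
  have mcx : measurable_fun setT (fun y : n.-tuple X => cat_pair (x, y)).
    by apply: measurableT_comp => //; exact: measurable_cat_pair.
  apply: ge0_le_integral => //.
  + by move=> y _; rewrite lee_fin.
  + apply/measurable_EFinP; apply: (@measurableT_comp _ _ _ _ _ _
      (fun z => w (trace S z)) _ (fun y => cat_pair (x, y))) => //.
    by apply: measurable_trace_fun; exact: mSS.
  + exact: (measurableT_comp mW mcx).
  move=> y _ /=; rewrite /W (bigD1 (trace S (cat_pair (x, y))))//=.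
  rewrite indicE mem_set ?mule1; last first.
    by have [_ _ _ _] := coverP (trace S (cat_pair (x, y))); apply; exists S.
  by rewrite leeDl// sume_ge0// => I _; rewrite mule_ge0// lee_fin.
rewrite -fubini_tonelli1//; last by move=> z; exact: W0.
have -> : (\int[power_probability P n \x power_probability P n]_z
    (W \o @cat_pair _ X n) z = \int[mu]_z W z)%E.
  rewrite -(@eq_measure_integral _ _ _ setT mu (distribution
     (power_probability P n \x power_probability P n)%E (@cat_pair _ X n))).
    by rewrite /distribution ge0_integral_pushforward//; exact: measurable_cat_pair.
  by move=> B mB _; exact: distribution_cat_pair.
rewrite ge0_integral_sum//; last by move=> I z _; rewrite mule_ge0// lee_fin.
rewrite (eq_bigr (fun I => (w I * freq I)%:E)); last first.
  move=> I _; rewrite ge0_integralZl_EFin//; last first.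
    exact/measurable_EFinP/measurable_indic.
  by rewrite integral_indic// setIT [X in (_ * X)%E](mu_cover I) EFinM.
rewrite sumEFin lee_fin.
have swI (s : {ffun 'I_n -> bool}) : \sum_I w I * freq I <=
    \sum_(I : {set 'I_(n + n)}) w (swap_halves s @^-1: I)%SET * freq I.
  rewrite (reindex_inj (h := fun I : {set 'I_(n + n)} =>
      (swap_halves s @^-1: I)%SET)).
    by apply: ler_sum => I _; apply: ler_wpM2l; rewrite ?w0 ?freq_swap.
  by apply: inv_inj => I; apply/setP => i; rewrite !inE swap_halvesK.
(* average over the 2 ^+ n swaps *)
rewrite -(@ler_pM2l _ (2 ^+ n)) ?exprn_gt0//.
apply: (@le_trans _ _ (\sum_(s : {ffun 'I_n -> bool})
    \sum_(I : {set 'I_(n + n)}) w (swap_halves s @^-1: I)%SET * freq I)).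
  have -> : 2 ^+ n = \sum_(s : {ffun 'I_n -> bool}) 1 :> R.
    by rewrite sumr_const card_ffun card_bool card_ord natrX.
  by rewrite mulr_suml; apply: ler_sum => s _; rewrite mul1r.
rewrite exchange_big/=; apply: (@le_trans _ _ (\sum_I (2 ^+ n * rho) * freq I)).
  by apply: ler_sum => I _; rewrite -mulr_suml ler_wpM2r.
rewrite -mulr_sumr -!mulrA ler_wpM2l ?exprn_ge0// mulrC ler_wpM2r//.
exact: sum_freq_le.
Qed.

End symmetrization.

(** * The confidence maps *)

Section confidence_map_theory.
Variable R : realType.
Implicit Types (tau eps p q t : R).

Lemma hplus01 tau t : 0 <= tau -> 0 <= t -> 0 <= hplus tau t <= 1.
Proof.
move=> tau0 t0; rewrite /hplus ge_min lexx orbT andbT le_min ler01 andbT.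
by rewrite !addr_ge0 ?sqrtr_ge0.
Qed.

Lemma hplus_unit_intervalE eps t : 0 <= eps -> 0 <= t <= 1 ->
  hplus (eps ^+ 2) t = Num.min (Num.min (t + eps * Num.sqrt t + eps ^+ 2)
    (t + eps * Num.sqrt (1 - t) + eps ^+ 2)) 1.
Proof.
move=> e0 /andP[t0 t1]; rewrite /hplus; congr Num.min.
have -> : vfun t = Num.min t (1 - t) by rewrite /vfun (max_l (_ : 0 <= 1 - t))// subr_ge0.
rewrite sqrtrM ?sqr_ge0// sqrtr_sqr ger0_norm//.
have [t1t|t1t] := leP t (1 - t).
  rewrite min_l// lerD2r lerD2l ler_wpM2l// ler_sqrt//; lra.
rewrite min_r// lerD2r lerD2l ler_wpM2l// ler_sqrt//; lra.
Qed.

(** The branch [t + e * sqrt (1 - t) + e ^+ 2] decreases once [sqrt (1 - t)] is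
    below [e / 2], but it is already at least 1 when [sqrt (1 - t) <= e]. *)
Lemma hplus_mono tau : 0 <= tau -> {in `[0, 1] &, {homo hplus tau : s t / s <= t}}.
Proof.
move=> tau0 s t; rewrite !in_itv/= => s01 t01 st.
rewrite -(sqr_sqrtr tau0); set e := Num.sqrt tau.
have e0 : 0 <= e by exact: sqrtr_ge0.
rewrite !hplus_unit_intervalE//.
move: s01 t01 => /andP[s0 s1] /andP[t0 t1].
rewrite !le_min !ge_min lexx !orbT/= andbT.
have -> /= : s + e * Num.sqrt s + e ^+ 2 <= t + e * Num.sqrt t + e ^+ 2.
  by rewrite lerD2r lerD// ler_wpM2l// ler_wsqrtr.
set u := Num.sqrt (1 - s); set v := Num.sqrt (1 - t).
have u2 : u ^+ 2 = 1 - s by rewrite sqr_sqrtr// subr_ge0.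
have v2 : v ^+ 2 = 1 - t by rewrite sqr_sqrtr// subr_ge0.
have v0 : 0 <= v by exact: sqrtr_ge0.
have vu : v <= u by rewrite ler_wsqrtr// lerD2l lerN2.
have [ve|ev] := leP v e.
  have t1' : 1 <= t + e * v + e ^+ 2.
    rewrite (_ : t = 1 - v ^+ 2); last by rewrite v2; ring.
    rewrite !expr2; nra.
  by rewrite t1' !orbT.
suff -> : s + e * u + e ^+ 2 <= t + e * v + e ^+ 2 by rewrite !orbT.
rewrite (_ : t = 1 - v ^+ 2); last by rewrite v2; ring.
rewrite (_ : s = 1 - u ^+ 2); last by rewrite u2; ring.
rewrite !expr2; nra.
Qed.

(** The first relative deviation bound, solved as a quadratic inequality in
    [sqrt p], gives the branch of [hplus] with [sqrt q]; the second one, for the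
    complementary set, gives the branch with [sqrt (1 - q)]. *)
Lemma le_hplus eps p q : 0 <= eps -> 0 <= p <= 1 -> 0 <= q <= 1 ->
  p - q <= eps * Num.sqrt p -> (1 - q) - (1 - p) <= eps * Num.sqrt (1 - q) ->
  p <= hplus (eps ^+ 2) q.
Proof.
move=> e0 /andP[p0 p1] q01 pq pq'; rewrite hplus_unit_intervalE//.
have /andP[q0 q1] := q01; rewrite !le_min p1 andbT; apply/andP; split; last first.
  have := sqr_ge0 eps; lra.
have sp : Num.sqrt p ^+ 2 = p by rewrite sqr_sqrtr.
have sq : Num.sqrt q ^+ 2 = q by rewrite sqr_sqrtr.
have sp0 := sqrtr_ge0 p; have sq0 := sqrtr_ge0 q.
have [h|h] := leP (Num.sqrt p) (Num.sqrt q + eps).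
  have : eps * Num.sqrt p <= eps * (Num.sqrt q + eps) by rewrite ler_wpM2l.
  rewrite expr2; lra.
exfalso; move: pq; rewrite -{1}sp -{1}sq !expr2; nra.
Qed.

Lemma lt_hplus_inv tau s t : 0 <= s <= 1 -> s < hplus_inv tau t -> hplus tau s < t.
Proof.
move=> s01 st; rewrite ltNge; apply/negP => ts.
move: st; rewrite ltNge => /negP; apply; apply: ge_inf; last by split.
by exists 0 => r /= [/andP[]].
Qed.

End confidence_map_theory.

(** * Uniform relative deviations *)

Section uniform_deviation.
Context d (X : measurableType d) (R : realType).
Variables (P : probability X R) (n : nat).
Hypothesis n_gt0 : (0 < n)%N.
Implicit Types (S : set X) (x y : n.-tuple X).

Local Notation prob S := (fine (P S)).

Lemma prob01 S : measurable S -> 0 <= prob S <= 1.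
Proof.
move=> mS; rewrite fine_ge0//= -lee_fin fineK ?fin_num_measure//.
exact: probability_le1.
Qed.

Lemma probC S : measurable S -> prob (~` S) = 1 - prob S.
Proof.
move=> mS; rewrite probability_setC// fineB// ?fin_num_measure//.
Qed.

Lemma empirical01 x S : 0 <= empirical R x S <= 1.
Proof.
rewrite /empirical mulr_ge0 ?invr_ge0//=; last by rewrite sumr_ge0.
rewrite mulrC ler_pdivrMr ?ltr0n// mul1r.
have -> : n%:R = \sum_(i < n) 1 :> R by rewrite sumr_const card_ord.
by apply: ler_sum => i _; rewrite indicE; case: (_ \in _).
Qed.

Lemma empiricalC x S : empirical R x (~` S) = 1 - empirical R x S.
Proof.
rewrite /empirical -[X in X - _](@mulVf _ n%:R) ?pnatr_eq0 -?lt0n// -mulrBr.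
congr (_ * _).
have -> : n%:R = \sum_(i < n) 1 :> R by rewrite sumr_const card_ord.
rewrite -sumrB; apply: eq_bigr => i _; rewrite !indicE.
by rewrite in_setC; case: (_ \in _); rewrite ?subrr ?subr0.
Qed.

Lemma lfreq_trace x y S : lfreq R (trace S (cat_pair (x, y))) = empirical R x S.
Proof.
rewrite /lfreq /empirical; congr (_ * _); apply: eq_bigr => i _.
rewrite indicE !inE tnth_cat_pair_l/=; congr (_%:R).
Qed.

Lemma rfreq_trace x y S : rfreq R (trace S (cat_pair (x, y))) = empirical R y S.
Proof.
rewrite /rfreq /empirical; congr (_ * _); apply: eq_bigr => i _.
rewrite indicE !inE tnth_cat_pair_r/=; congr (_%:R).
Qed.

Lemma power_probability_tnth i S : measurable S ->
  power_probability P n [set y | S (tnth y i)] = P S.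
Proof.
move=> mS; rewrite (_ : [set _ | _] = rectangle (fun j => if j == i then S else setT)).
  rewrite power_probability_rectangle; last by move=> j; case: ifP.
  rewrite (bigD1 i)//= eqxx big1 ?mule1// => j /negbTE ->.
  exact: probability_setT.
apply/seteqP; split => y /=; last by move=> /(_ i); rewrite eqxx.
by move=> Sy j; case: ifPn => // /eqP ->.
Qed.

Lemma measurable_coordinate i S : measurable S ->
  measurable [set y : n.-tuple X | S (tnth y i)].
Proof.
by move=> mS; rewrite -[X in measurable X]setTI; exact: measurable_tnth.
Qed.

Lemma measurable_empirical S : measurable S ->
  measurable_fun setT (fun y : n.-tuple X => empirical R y S).
Proof.
move=> mS; apply: measurable_funM => //; apply: measurable_sum => i.
exact: (measurable_indic (measurable_coordinate i mS)).
Qed.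

Lemma integral_empirical S : measurable S ->
  (\int[power_probability P n]_y (empirical R y S)%:E = P S)%E.
Proof.
move=> mS; under eq_integral do rewrite /empirical EFinM -sumEFin.
have mi i : measurable_fun setT (fun y : n.-tuple X => (\1_S (tnth y i) : R)%:E).
  by apply/measurable_EFinP; exact: (measurable_indic (measurable_coordinate i mS)).
rewrite ge0_integralZl_EFin ?invr_ge0//.
- rewrite ge0_integral_sum//.
  rewrite (eq_bigr (fun=> (prob S)%:E)) => [|i _]; last first.
    rewrite fineK ?fin_num_measure//.
    rewrite [LHS](_ : _ = \int[power_probability P n]_y
        (\1_([set y | S (tnth y i)]) y)%:E)%E//.
    rewrite (integral_indic _ measurableT (measurable_coordinate i mS)) setIT.
    exact: power_probability_tnth.
  rewrite sumEFin sumr_const card_ord -EFinM -[X in _ * X]mulr_natl.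
  by rewrite mulKf ?fineK ?fin_num_measure// pnatr_eq0 -lt0n.
- by move=> y _; apply: sume_ge0 => i _; rewrite lee_fin.
- exact: emeasurable_sum.
Qed.

Lemma integrable_empirical S : measurable S ->
  (power_probability P n).-integrable setT (fun y => (empirical R y S)%:E).
Proof.
move=> mS; apply: measurable_bounded_integrable => //.
- by rewrite [ltLHS]probability_setT ltry.
- exact: measurable_empirical.
exists 1; split => // r r1 y _ /=.
by have /andP[e0 e1] := empirical01 y S; rewrite ger0_norm// (le_trans e1)// ltW.
Qed.

(** The frequency in the ghost sample is unbiased, so the integral of an affine
    function of it is the value of that function at the true probability. *)
Lemma affine_minorant_integral S (al be : R) (f : n.-tuple X -> R) :
  measurable S -> measurable_fun setT f -> (forall y, 0 <= f y) ->
  (forall y, al + be * empirical R y S <= f y) ->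
  1 <= al + be * prob S ->
  (1 <= \int[power_probability P n]_y (f y)%:E)%E.
Proof.
move=> mS mf f0 alf al1.
have [foo|] := ltP (\int[power_probability P n]_y (f y)%:E)%E +oo%E; last first.
  by rewrite leye_eq => /eqP ->; rewrite leey.
have intf : (power_probability P n).-integrable setT (EFin \o f).
  apply/integrableP; split; first exact/measurable_EFinP.
  by under eq_integral do rewrite /= ger0_norm//.
have inte := integrable_empirical mS.
have intZ : (power_probability P n).-integrable setT
    (fun y => be%:E * (empirical R y S)%:E)%E by exact: integrableZl.
have intc : (power_probability P n).-integrable setT (cst al%:E).
  exact: (finite_measure_integrable_cst _ _ measurableT).
have h2 : (\int[power_probability P n]_y (cst al%:E y + be%:E * (empirical R y S)%:E)
    <= \int[power_probability P n]_y (EFin \o f) y)%E.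
  apply: le_integral => //; first exact: (integrableD measurableT intc intZ).
  by move=> y _; rewrite /= -EFinM -EFinD lee_fin.
apply: le_trans h2.
rewrite integralD// integral_cst// [X in (_ * X)%E]probability_setT mule1.
rewrite integralZl// integral_empirical//.
by rewrite -[P S]fineK ?fin_num_measure// -EFinM -EFinD lee_fin.
Qed.

Section relative_deviation.
Variable eps : R.
Hypothesis eps_gt0 : 0 < eps.
Hypothesis n_eps : 4 <= n%:R * eps ^+ 2.
Let k := n%:R * eps ^+ 2 / 2.

Let k2 : 2 <= k.
Proof. by rewrite /k ler_pdivlMr// (le_trans _ n_eps)// -natrM. Qed.

(** For a trace on the double sample, sample first: the weight that detects a
    true probability far above the frequency in the sample, then the one that
    detects a true probability far below it. *)
Definition weight_up (I : {set 'I_(n + n)}) : R :=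
  deviation_weight eps k (rfreq R I) (lfreq R I).
Definition weight_down (I : {set 'I_(n + n)}) : R :=
  deviation_weight eps k (lfreq R I) (rfreq R I).

Let measurable_weight (w : {set 'I_(n + n)} -> R) S x : measurable S ->
  measurable_fun setT (fun y : n.-tuple X => w (trace S (cat_pair (x, y)))).
Proof.
move=> mS; apply: (@measurableT_comp _ _ _ _ _ _
      (fun z => w (trace S z)) _ (fun y => cat_pair (x, y))) => //.
  exact: measurable_trace_fun.
by apply: measurableT_comp => //; exact: measurable_cat_pair.
Qed.

Lemma weight_up_ge1 S x : measurable S ->
  eps * Num.sqrt (prob S) < prob S - empirical R x S ->
  (1 <= \int[power_probability P n]_y (weight_up (trace S (cat_pair (x, y))))%:E)%E.
Proof.
move=> mS dev; have /andP[e0 e1] := empirical01 x S.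
have p0 : 0 < prob S.
  have : 0 <= eps * Num.sqrt (prob S) by rewrite mulr_ge0 ?sqrtr_ge0// ltW.
  lra.
have sp0 : 0 < eps * Num.sqrt (prob S) by rewrite mulr_gt0// sqrtr_gt0.
set c := (eps * Num.sqrt (prob S))^-1.
apply: (@affine_minorant_integral S (1 + k * (- empirical R x S * c - 1)) (k * c)) => //.
- exact: measurable_weight.
- by move=> y; exact: deviation_weight_ge0.
- move=> y; rewrite /weight_up lfreq_trace rfreq_trace.
  have /andP[g0 g1] := empirical01 y S.
  apply: le_trans (affine_le_deviation_above eps_gt0 k2 p0 g0 e0 (ltW dev)).
  by rewrite le_eqVlt -/c; apply/orP; left; apply/eqP; ring.
have c1 : 1 <= (prob S - empirical R x S) * c by rewrite ler_pdivlMr// mul1r ltW.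
have : 0 <= k * ((prob S - empirical R x S) * c - 1) by apply: mulr_ge0; have := k2; lra.
by move: c1 => _; lra.
Qed.

Lemma weight_down_ge1 S x : measurable S ->
  eps * Num.sqrt (empirical R x S) < empirical R x S - prob S ->
  (1 <= \int[power_probability P n]_y (weight_down (trace S (cat_pair (x, y))))%:E)%E.
Proof.
move=> mS dev; have /andP[e0 e1] := empirical01 x S.
have /andP[p0 p1] := prob01 mS.
have e0' : 0 < empirical R x S.
  have : 0 <= eps * Num.sqrt (empirical R x S) by rewrite mulr_ge0 ?sqrtr_ge0// ltW.
  lra.
have sp0 : 0 < eps * Num.sqrt (empirical R x S) by rewrite mulr_gt0// sqrtr_gt0.
set c := (eps * Num.sqrt (empirical R x S))^-1.
apply: (@affine_minorant_integral S (1 + k * (empirical R x S * c - 1)) (- (k * c))) => //.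
- exact: measurable_weight.
- by move=> y; exact: deviation_weight_ge0.
- move=> y; rewrite /weight_down lfreq_trace rfreq_trace.
  have /andP[g0 g1] := empirical01 y S.
  have k1 : 1 <= k by have := k2; lra.
  apply: le_trans (affine_le_deviation_below eps_gt0 k1 e0' g0).
  by rewrite le_eqVlt -/c; apply/orP; left; apply/eqP; ring.
have c1 : 1 <= (empirical R x S - prob S) * c by rewrite ler_pdivlMr// mul1r ltW.
have : 0 <= k * ((empirical R x S - prob S) * c - 1) by apply: mulr_ge0; have := k2; lra.
by move: c1 => _; lra.
Qed.

Definition two_sided (p q : R) :=
  [/\ p <= hplus (eps ^+ 2) q, q <= hplus (eps ^+ 2) p,
     1 - p <= hplus (eps ^+ 2) (1 - q) & 1 - q <= hplus (eps ^+ 2) (1 - p)].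

Let weight I := (weight_up I + weight_down I) +
  (weight_up (finset.setC I) + weight_down (finset.setC I)).

Let wge0 I : (0 <= weight_up I) * (0 <= weight_down I).
Proof. by split; exact: deviation_weight_ge0. Qed.

Let weight_ge0 I : 0 <= weight I.
Proof.
exact: (addr_ge0 (addr_ge0 (wge0 _).1 (wge0 _).2) (addr_ge0 (wge0 _).1 (wge0 _).2)).
Qed.

(** If the four relative deviation bounds hold, for [S] and its complement in
    both directions, then [le_hplus] gives the four inequalities. *)
Let not_two_sided_weight S x : measurable S ->
  ~ two_sided (prob S) (empirical R x S) ->
  (1 <= \int[power_probability P n]_y (weight (trace S (cat_pair (x, y))))%:E)%E.
Proof.
move=> mS ntwo; have mSC : measurable (~` S) by exact: measurableC.
have dom (S' : set X) (w : {set 'I_(n + n)} -> R) : measurable S' ->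
    (forall I, 0 <= w I) ->
    (forall y, w (trace S' (cat_pair (x, y))) <= weight (trace S (cat_pair (x, y)))) ->
    (1 <= \int[power_probability P n]_y (w (trace S' (cat_pair (x, y))))%:E)%E ->
    (1 <= \int[power_probability P n]_y (weight (trace S (cat_pair (x, y))))%:E)%E.
  move=> mS' w0 ww /le_trans; apply; apply: ge0_le_integral => //.
  - by move=> y _; rewrite lee_fin.
  - by apply/measurable_EFinP; exact: (measurable_weight w x mS').
  - by apply/measurable_EFinP; exact: (measurable_weight weight x mS).
  - by move=> y _; rewrite lee_fin.
have [|d1] := ltP (eps * Num.sqrt (prob S)) (prob S - empirical R x S).
  move=> /(weight_up_ge1 mS); apply: dom => // [I|y]; rewrite ?wge0//.
  rewrite /weight -addrA lerDl; exact: (addr_ge0 (wge0 _).2 (addr_ge0 (wge0 _).1 (wge0 _).2)).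
have [|d2] := ltP (eps * Num.sqrt (empirical R x S)) (empirical R x S - prob S).
  move=> /(weight_down_ge1 mS); apply: dom => // [I|y]; rewrite ?wge0//.
  rewrite /weight addrAC lerDr; exact: (addr_ge0 (wge0 _).1 (addr_ge0 (wge0 _).1 (wge0 _).2)).
have [|d3] := ltP (eps * Num.sqrt (prob (~` S))) (prob (~` S) - empirical R x (~` S)).
  move=> /(weight_up_ge1 mSC); apply: dom => // [I|y]; rewrite ?wge0//.
  rewrite traceC /weight addrCA lerDl; exact: (addr_ge0 (addr_ge0 (wge0 _).1 (wge0 _).2) (wge0 _).2).
have [|d4] := ltP (eps * Num.sqrt (empirical R x (~` S))) (empirical R x (~` S) - prob (~` S)).
  move=> /(weight_down_ge1 mSC); apply: dom => // [I|y]; rewrite ?wge0//.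
  rewrite traceC /weight addrA lerDr; exact: (addr_ge0 (addr_ge0 (wge0 _).1 (wge0 _).2) (wge0 _).1).
have p01 := prob01 mS; have q01 := empirical01 x S.
have [p0 p1] := andP p01; have [q0 q1] := andP q01.
have pC01 : 0 <= 1 - prob S <= 1 by rewrite subr_ge0 p1 lerBlDr lerDl.
have qC01 : 0 <= 1 - empirical R x S <= 1 by rewrite subr_ge0 q1 lerBlDr lerDl.
rewrite probC// empiricalC in d3 d4.
exfalso; apply: ntwo; split; apply: le_hplus; rewrite ?(ltW eps_gt0)//;
  rewrite ?[1 - (1 - _)]subKr//.
Qed.

Let weight_swap (I : {set 'I_(n + n)}) :
  \sum_(s : {ffun 'I_n -> bool}) weight (swap_halves s @^-1: I)%SET <=
  2 ^+ n * (4 * expR (- (n%:R * eps ^+ 2 / 4))).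
Proof.
have up J := deviation_weight_swap_rl J eps_gt0 n_gt0.
have down J := deviation_weight_swap_lr J eps_gt0 n_gt0.
rewrite /weight !big_split/=.
have upC := up (finset.setC I); have downC := down (finset.setC I).
have upE : \sum_(s : {ffun 'I_n -> bool})
      weight_up (finset.setC (swap_halves s @^-1: I)%SET) =
    \sum_(s : {ffun 'I_n -> bool}) weight_up (swap_halves s @^-1: finset.setC I)%SET.
  by apply: eq_bigr => s _; rewrite preimsetC.
have downE : \sum_(s : {ffun 'I_n -> bool})
      weight_down (finset.setC (swap_halves s @^-1: I)%SET) =
    \sum_(s : {ffun 'I_n -> bool}) weight_down (swap_halves s @^-1: finset.setC I)%SET.
  by apply: eq_bigr => s _; rewrite preimsetC.
rewrite upE downE.
have e4 (a e : R) : a * (4 * e) = a * e + a * e + (a * e + a * e) by ring.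
by rewrite e4 ?lerD//; [exact: up|exact: down].
Qed.

(** The relative deviation inequality of Vapnik and Chervonenkis, with constant
    4 for the two directions and the two sets [S] and [~` S]. *)
Lemma uniform_deviation (SS : set (set X)) (K : R) :
  SS `<=` measurable -> trace_measurable R SS ->
  (forall z : (n + n).-tuple X, #|traces SS z|%:R <= K) ->
  exists g : n.-tuple X -> \bar R, [/\ measurable_fun setT g,
    forall x, (0 <= g x)%E,
    forall x, ~ (forall S, SS S -> two_sided (prob S) (empirical R x S)) -> (1 <= g x)%E &
    (\int[power_probability P n]_x g x <=
      (K * (4 * expR (- (n%:R * eps ^+ 2 / 4))))%:E)%E].
Proof.
move=> mSS tSS tK; apply: (symmetrization mSS tSS _ tK weight_ge0 weight_swap).
  by rewrite mulr_ge0 ?expR_ge0.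
move=> x /existsNP[S /not_implyP[SS_S ntwo]].
by exists S => //; apply: not_two_sided_weight => //; exact: mSS.
Qed.

End relative_deviation.

End uniform_deviation.

(** * Counting traces by the VC dimension *)

Section trace_count.
Local Open Scope card_scope.
Context d (X : measurableType d) (R : realType).
Implicit Types (S : set X) (SS : set (set X)).

Lemma card_eq_set_finType (T : finType) (A : {set T}) : [set` A] #= `I_#|A|.
Proof.
have <- : [set index x (enum A) | x in [set` A]] = `I_#|A|.
  apply/seteqP; split => [_ [x xA <-]|k /= kA].
    by rewrite /= cardE index_mem mem_enum.
  exists (enum_val (Ordinal kA)); first exact: enum_valP.
  by rewrite (enum_val_nth (enum_val (Ordinal kA))) index_uniq ?enum_uniq// -cardE.
rewrite card_eq_sym; apply: inj_card_eq => x y; rewrite !inE => xA yA xy.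
by apply: (@index_inj _ x (enum A)) xy; rewrite mem_enum.
Qed.

(** If the traces on a sample shatter the index set [A], then the sample is
    injective on [A], since a set of the class separates any two indices; hence
    [A] and the points it indexes have the same number of subsets. *)
Lemma shattered_trace_shatters m SS (z : m.-tuple X) (A : {set 'I_m}) :
  fshattered (traces SS z) A ->
  exists2 B : set X, B #= `I_#|A| & shatters SS B.
Proof.
move=> /fshatteredP shA.
have shS (C : {set 'I_m}) : C \subset A ->
    exists2 S, SS S & finset.setI (trace S z) A = C.
  move=> /shA[I]; rewrite inE => /asboolP[S SS_S <-] SAC.
  by exists S.
have zinj : {in A &, injective (tnth z)}.
  move=> i j iA jA zij; apply/eqP; apply/negPn/negP => ij.
  have [S SS_S SAi] : exists2 S, SS S & finset.setI (trace S z) A = finset.set1 i.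
    by apply: shS; rewrite finset.sub1set.
  have : i \in finset.setI (trace S z) A by rewrite SAi finset.set11.
  rewrite finset.in_setI => /andP[/traceP Si _].
  have : j \in finset.setI (trace S z) A.
    by rewrite finset.in_setI jA andbT; apply/traceP; rewrite -zij.
  by rewrite SAi finset.in_set1 => /eqP ji; rewrite ji eqxx in ij.
pose B := [set tnth z i | i in [set` A]].
have BA : B #= `I_#|A|.
  apply: card_eq_trans (card_eq_set_finType A).
  by apply: inj_card_eq => i j; rewrite !inE; exact: zinj.
exists B => //; exists #|A| => //.
have -> : [set B `&` S | S in SS] =
    [set [set tnth z i | i in [set` C]] | C in [set` finset.powerset A]].
  apply/seteqP; split => [_ [S SS_S <-]|_ [C /= CA <-]].
    exists (finset.setI (trace S z) A) => /=.
      by rewrite finset.powersetE finset.subsetIr.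
    apply/seteqP; split => [x [i /=]|x [[i iA <-] Si]].
      rewrite finset.in_setI => /andP[/traceP Si iA] <-; split => //.
      by exists i.
    by exists i => //=; rewrite finset.in_setI; apply/andP; split => //; apply/traceP.
  rewrite finset.powersetE in CA; have [S SS_S SAC] := shS _ CA.
  exists S => //; apply/seteqP; split => [x [[i iA <-] Si]|x [i /= iC <-]].
    by exists i => //=; rewrite -SAC finset.in_setI; apply/andP; split => //; apply/traceP.
  move: iC; rewrite -SAC finset.in_setI => /andP[/traceP Si iA].
  by split => //; exists i.
rewrite -finset.card_powerset; apply: card_eq_trans (card_eq_set_finType _).
apply: inj_card_eq => C D; rewrite !inE /= !finset.powersetE => CA DA CD.
suff incl (C' D' : {set 'I_m}) : C' \subset A -> D' \subset A ->
    [set tnth z i | i in [set` C']] = [set tnth z i | i in [set` D']] ->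
    C' \subset D'.
  by apply/eqP; rewrite finset.eqEsubset; apply/andP; split; apply: incl => //; exact/esym.
move=> /fintype.subsetP CA' /fintype.subsetP DA' E; apply/fintype.subsetP => i iC.
have : [set tnth z i | i in [set` D']] (tnth z i) by rewrite -E; exists i.
by move=> [j jD /zinj <-//]; [exact: DA'|exact: CA'].
Qed.

Lemma le_VC SS (B : set X) k : B #= `I_k -> shatters SS B -> (k%:R%:E <= VC R SS)%E.
Proof. by move=> Bk shB; apply: ereal_sup_ubound; exists k => //; exists B. Qed.

Lemma fine_VC_ge0 SS : (VC R SS < +oo)%E -> 0 <= fine (VC R SS).
Proof.
move=> VCoo; have [-> //|VCNy] := eqVneq (VC R SS) -oo%E.
have : ~ (VC R SS <= -oo)%E by rewrite leeNy_eq; exact/negP.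
apply: contra_notP => VC0; apply: ge_ereal_sup => _ [k [B Bk shB] <-].
exfalso; apply: VC0; apply: fine_ge0; apply: le_trans (le_VC Bk shB).
by rewrite lee_fin.
Qed.

(** The largest index set shattered by the traces is no larger than the VC
    dimension; it exists as soon as there is a trace, the empty set being then
    shattered. *)
Lemma card_traces_le m SS (z : m.-tuple X) : (1 < m)%N -> (VC R SS < +oo)%E ->
  #|traces SS z|%:R <= 2 * expR (fine (VC R SS) * ln m%:R) :> R.
Proof.
move=> m1 VCoo; have [T0|[I TI]] := finset.set_0Vmem (traces SS z).
  by rewrite T0 cards0 mulr_ge0// expR_ge0.
have sh0 : fshattered (traces SS z) finset.set0.
  apply/fshatteredP => B; rewrite finset.subset0 => /eqP ->.
  by exists I => //; rewrite finset.setI0.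
have [A shA Amax] := @arg_maxnP _ finset.set0 (fshattered (traces SS z))
  (fun A => #|A|) sh0.
have : (#|traces SS z| <= 2 * m ^ #|A|)%N.
  by have := @sauer_shelah _ (traces SS z) #|A|; rewrite !card_ord; exact.
rewrite -(ler_nat R) => /le_trans; apply.
rewrite natrM natrX ler_pM2l// -[m%:R in leLHS]lnK ?posrE ?ltr0n ?(ltn_trans _ m1)//.
rewrite -expRM_natl ler_expR ler_wpM2r//.
  by rewrite ln_ge0// ler1n ltnW.
have [B BA shB] := shattered_trace_shatters shA.
have kVC := le_VC BA shB.
rewrite -lee_fin fineK// fin_numE (lt_eqF VCoo) andbT.
apply/eqP => VCN; rewrite VCN leeNy_eq in kVC; by [].
Qed.

End trace_count.

(** * Supporting lines and likelihood ratio regions *)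

Section supporting_line.
Variable R : realType.
Implicit Types (f : R -> R) (a b t : R).

Lemma trade_off_function_convex f t a b : is_trade_off_function f ->
  0 <= t <= 1 -> 0 <= a <= 1 -> 0 <= b <= 1 ->
  f (t * a + (1 - t) * b) <= t * f a + (1 - t) * f b.
Proof.
move=> [cf _ _ _ _] /andP[t0 t1] a01 b01.
have := cf (Itv01 t0 t1) a b; rewrite !inE/= !in_itv/= => /(_ a01 b01).
by rewrite !convRE.
Qed.

(** Right continuity at 0 moves the level away from the endpoint, where a
    convex function may have an infinite slope. *)
Lemma trade_off_function_right0 f c : is_trade_off_function f -> c < f 0 ->
  exists2 a, 0 < a < 1 & c < f a.
Proof.
move=> [_ cf _ _ _] cf0.
have /(continuous_within_itvP _ ltr01)[_ f0 _] := cf.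
have : \forall a \near 0^'+, c < f a by exact: (cvgr_gt _ f0).
move=> cfa.
have : \forall a \near (0 : R)^'+, 0 < a < 1 /\ c < f a.
  near=> a; split; last by near: a.
  by apply/andP; split; near: a; [exact: nbhs_right_gt|exact: nbhs_right_lt].
by move=> /filter_ex[a [a01 ca]]; exists a.
Unshelve. all: by end_near. Qed.

(** The witness [lam] is the infimum of the slopes of the chords to the left
    of [a]; by convexity these dominate the slopes of the chords to the right,
    and they are nonnegative because [f] is nonincreasing. *)
Lemma trade_off_function_support f a : is_trade_off_function f -> 0 < a < 1 ->
  exists2 lam, 0 <= lam & forall b, 0 <= b <= 1 -> f a - lam * (b - a) <= f b.
Proof.
move=> tf /andP[a0 a1]; have [_ _ fmono _ _] := tf.
have a01 : 0 <= a <= 1 by rewrite !ltW.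
pose slope b := (f b - f a) / (a - b).
pose A := [set slope b | b in [set b | 0 <= b < a]].
have fge b c : 0 <= b <= 1 -> 0 <= c <= 1 -> b <= c -> f c <= f b.
  by move=> b01 c01; apply: fmono; rewrite in_itv.
have slope_ge0 b : 0 <= b < a -> 0 <= slope b.
  move=> /andP[b0 ba]; apply: divr_ge0; rewrite subr_ge0 ?(ltW ba)//.
  by apply: fge => //; rewrite ?(ltW ba)// b0 ltW// (lt_trans ba).
have A0 : A !=set0 by exists (slope 0); exists 0 => //=; rewrite lexx.
have lbA x : (forall b, 0 <= b < a -> x <= slope b) -> x <= inf A.
  by move=> xb; apply: lb_le_inf => // _ [b ba <-]; exact: xb.
exists (inf A); first exact: lbA.
move=> b /andP[b0 b1]; have [ba|ab|->] := ltgtP b a; last by rewrite subrr mulr0 subr0.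
  have : inf A <= slope b.
    by apply: ge_inf; [exists 0 => _ [c ca <-]; exact: slope_ge0|exists b => //=; rewrite b0].
  rewrite /slope ler_pdivlMr ?subr_gt0//; lra.
suff : (f a - f b) / (b - a) <= inf A.
  rewrite ler_pdivrMr ?subr_gt0//; lra.
apply: lbA => c /andP[c0 ca].
rewrite /slope ler_pdivrMr ?subr_gt0// mulrAC ler_pdivlMr ?subr_gt0//.
have bc : 0 < b - c by lra.
pose t := (b - a) / (b - c).
have t01 : 0 <= t <= 1.
  by rewrite /t divr_ge0 ?ler_pdivrMr ?mul1r//; lra.
have c01 : 0 <= c <= 1 by rewrite c0 ltW// (lt_trans ca).
have b01 : 0 <= b <= 1 by rewrite b0.
have := trade_off_function_convex tf t01 c01 b01.
have -> : t * c + (1 - t) * b = a by rewrite /t; field; rewrite gt_eqF.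
have -> : t * f c + (1 - t) * f b = ((b - a) * f c + (a - c) * f b) / (b - c).
  by rewrite /t; field; rewrite gt_eqF.
rewrite ler_pdivlMr//; lra.
Qed.

End supporting_line.

Lemma integral_onem_indic d (X : measurableType d) (R : realType)
    (Q : probability X R) (S : set X) : measurable S ->
  (\int[Q]_x (1 - \1_S x)%R%:E = Q (~` S))%E.
Proof.
move=> mS; rewrite (eq_integral (fun x => (\1_(~` S) x)%:E)).
  by rewrite integral_indic ?setIT//; exact: measurableC.
by move=> x _; rewrite indicC indicE; case: (_ \in _); rewrite ?subrr ?subr0.
Qed.

Section neyman_pearson.
Context d (X : measurableType d) (R : realType).
Variables P Q : probability X R.
Local Open Scope ereal_scope.
Local Open Scope charge_scope.
Local Notation mu := (@midpoint _ X R P Q).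
Local Notation p := (@densityP _ X R P Q).
Local Notation q := (@densityQ _ X R P Q).

Let p_fin x : p x \is a fin_num.
Proof. exact/Radon_Nikodym_fin_num/dominates_midpointl. Qed.

Let q_fin x : q x \is a fin_num.
Proof. exact/Radon_Nikodym_fin_num/dominates_midpointr. Qed.

Let p_int : mu.-integrable setT p.
Proof. exact/Radon_Nikodym_integrable/dominates_midpointl. Qed.

Let q_int : mu.-integrable setT q.
Proof. exact/Radon_Nikodym_integrable/dominates_midpointr. Qed.

(** Type II error plus [lam] times type I error. *)
Definition bayes_risk (lam : R) (phi : X -> R) : \bar R :=
  \int[Q]_x (1 - phi x)%R%:E + lam%:E * \int[P]_x (phi x)%:E.

Definition bayes_density (lam : R) (phi : X -> R) (x : X) : \bar R :=
  (1 - phi x)%R%:E * q x + lam%:E * ((phi x)%:E * p x).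

Definition is_test (phi : X -> R) :=
  measurable_fun setT phi /\ forall x, (0 <= phi x <= 1)%R.

Lemma is_testC phi : is_test phi -> is_test (fun x => 1 - phi x)%R.
Proof.
move=> [mphi phi01]; split; first exact: measurable_funB.
by move=> x; have /andP[h0 h1] := phi01 x; apply/andP; split; lra.
Qed.

Lemma is_test_indic S : measurable S -> is_test (\1_S).
Proof.
move=> mS; split; first exact: measurable_indic.
by move=> x; rewrite indicE; case: (_ \in _); rewrite ?lexx ler01.
Qed.

Lemma is_test_integrable (nu : probability X R) phi : is_test phi ->
  nu.-integrable setT (EFin \o phi).
Proof.
move=> [mphi phi01]; apply: measurable_bounded_integrable => //.
  by rewrite [ltLHS]probability_setT ltry.
exists 1%R; split => // r r1 x _ /=.
by have /andP[h0 h1] := phi01 x; rewrite ger0_norm// (le_trans h1)// ltW.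
Qed.

Let density_integrable phi (g : X -> \bar R) : is_test phi ->
  mu.-integrable setT g -> mu.-integrable setT (fun x => (phi x)%:E * g x).
Proof.
move=> [mphi phi01] gi; apply: (@integrableMr _ _ _ _ _ measurableT phi g) => //.
exists 1%R; split => // r r1 x _ /=.
by have /andP[h0 h1] := phi01 x; rewrite ger0_norm// (le_trans h1)// ltW.
Qed.

Lemma bayes_density_integrable lam phi : is_test phi ->
  mu.-integrable setT (bayes_density lam phi).
Proof.
move=> tphi; apply: integrableD => //; first exact/density_integrable/q_int/is_testC.
by apply: integrableZl => //; exact: density_integrable.
Qed.

Lemma bayes_riskE lam phi : is_test phi ->
  bayes_risk lam phi = \int[mu]_x bayes_density lam phi x.
Proof.
move=> tphi; have tphiC := is_testC tphi; rewrite integralD//; last 2 first.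
- exact: density_integrable.
- by apply: integrableZl => //; exact: density_integrable.
rewrite integralZl//; last exact: density_integrable.
congr (_ + _ * _).
  apply/esym/Radon_Nikodym_change_of_variables => //; first exact: dominates_midpointr.
  exact: (is_test_integrable _ tphiC).
apply/esym/Radon_Nikodym_change_of_variables => //; first exact: dominates_midpointl.
exact: (is_test_integrable _ tphi).
Qed.

(** Pointwise, the density of the weighted risk of a test is a convex
    combination of [q x] and [lam%:E * p x], and the likelihood ratio region
    picks the smaller of the two. *)
Lemma neyman_pearson (lam : R) (S : set X) phi : measurable S ->
  {ae mu, forall x, \1_S x = \1_(lr_region P Q lam%:E) x :> R} -> is_test phi ->
  Q (~` S) + lam%:E * P S <= bayes_risk lam phi.
Proof.
move=> mS aeS tphi; have tS := is_test_indic mS.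
have -> : Q (~` S) + lam%:E * P S = bayes_risk lam (\1_S).
  rewrite /bayes_risk integral_indic// setIT; congr (_ + _).
  exact/esym/integral_onem_indic.
rewrite !bayes_riskE//.
have mr : measurable (lr_region P Q lam%:E).
  rewrite /lr_region/=.
  rewrite -[X in measurable X]setTI; apply: measurable_lte => //.
    by apply: measurable_funeM; exact: measurable_int p_int.
  exact: measurable_int q_int.
have tr := is_test_indic mr.
rewrite (@ae_eq_integral _ _ _ mu setT (bayes_density lam (\1_(lr_region P Q lam%:E))))//.
- apply: le_integral => //; try exact: bayes_density_integrable.
  move=> x _; rewrite /bayes_density indicE.
  have /andP[h0 h1] := tphi.2 x.
  rewrite -[p x]fineK// -[q x]fineK//.
  case: (boolP (x \in _)); rewrite /lr_region/= ?inE ?notin_setE/=;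
    rewrite -[p x]fineK// -[q x]fineK// -!EFinM -!EFinD ?lte_fin lee_fin.
    nra.
  move=> /negP; rewrite -leNgt; nra.
- exact/measurable_int/bayes_density_integrable.
- exact/measurable_int/bayes_density_integrable.
by apply: filterS aeS => x Sx _; rewrite /bayes_density Sx.
Qed.

End neyman_pearson.

(** A test below the graph of [f] lies below a supporting line of [f].  The
    likelihood ratio region for the slope of this line minimizes the
    corresponding weighted risk, hence lies below the line too, hence below the
    graph. *)
Lemma attainable_below_trade_off d (X : measurableType d) (R : realType)
    (P Q : probability X R) (SS : set (set X)) (f : R -> R) :
  SS `<=` measurable -> is_trade_off_function f ->
  attainable P Q SS -> trade_off_nge P Q f ->
  exists2 S, SS S & fine (Q (~` S)) < f (fine (P S)).
Proof.
move=> mSS tf att [a0 a001 /ereal_inf_lt[_ [phi [mphi phi01 Pphi] <-]] Qphi].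
have tphi : is_test phi by [].
have [a a01 [Pa Qa]] : exists2 a, 0 < a < 1 &
    (\int[P]_x (phi x)%:E <= a%:E /\ \int[Q]_x (1 - phi x)%R%:E < (f a)%:E)%E.
  have Q0 : (0 <= \int[Q]_x (1 - phi x)%R%:E)%E.
    by apply: integral_ge0 => x _; rewrite lee_fin subr_ge0; case/andP: (phi01 x).
  have /andP[a00 a01] := a001; have [_ _ _ fb _] := tf.
  have a0lt1 : a0 < 1.
    rewrite lt_neqAle a01 andbT; apply/eqP => a0E.
    have := fb a0 a001; rewrite a0E subrr => /le_anti f10.
    by move: Qphi; rewrite a0E -f10 ltNge Q0.
  have [a0gt0|] := ltP 0 a0; first by exists a0; rewrite ?a0gt0.
  move=> a0le0; have a0E : a0 = 0 by apply/le_anti; rewrite a0le0.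
  have Qfin : (\int[Q]_x (1 - phi x)%R%:E)%E \is a fin_num.
    by rewrite ge0_fin_numE// (lt_trans Qphi)// ltry.
  have [|b b01 Qb] := @trade_off_function_right0 _ f (fine (\int[Q]_x (1 - phi x)%R%:E)%E) tf.
    by rewrite -lte_fin fineK// -a0E.
  exists b => //; split; last by rewrite -[ltLHS]fineK.
  by apply: le_trans Pphi _; rewrite lee_fin a0E; case/andP: b01 => /ltW.
have [lam lam0 sup] := trade_off_function_support tf a01.
have [S SS_S aeS] := att lam%:E lam0.
exists S => //; have mS := mSS S SS_S.
have mSC : measurable (~` S) by exact: measurableC.
have PS01 : 0 <= fine (P S) <= 1.
  by rewrite fine_ge0//= -lee_fin fineK ?fin_num_measure// probability_le1.
apply: lt_le_trans (sup _ PS01).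
have := neyman_pearson mS aeS tphi; rewrite /bayes_risk.
have Pfin : (\int[P]_x (phi x)%:E)%E \is a fin_num.
  rewrite ge0_fin_numE; first by rewrite (le_lt_trans Pa)// ltry.
  by apply: integral_ge0 => x _; rewrite lee_fin; case/andP: (phi01 x).
have Qfin : (\int[Q]_x (1 - phi x)%R%:E)%E \is a fin_num.
  rewrite ge0_fin_numE; first by rewrite (lt_trans Qa)// ltry.
  by apply: integral_ge0 => x _; rewrite lee_fin subr_ge0; case/andP: (phi01 x).
move: Pa Qa; rewrite -(fineK Pfin) -(fineK Qfin).
rewrite -[P S]fineK ?fin_num_measure// -[Q _]fineK ?fin_num_measure//.
rewrite -!EFinM -!EFinD !lee_fin lte_fin /= => Pa Qa NP.
have : lam * fine (\int[P]_x (phi x)%:E)%E <= lam * a by rewrite ler_wpM2l.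
lra.
Qed.

(** * The two error bounds *)

Section two_samples.
Context d (X : measurableType d) (R : realType).
Variables (P Q : probability X R) (n : nat).
Local Open Scope ereal_scope.

Lemma outer_expectation_sum_le (f : n.-tuple X * n.-tuple X -> R)
    (g h : n.-tuple X -> \bar R) (r : R) :
  measurable_fun setT g -> measurable_fun setT h ->
  (forall x, 0 <= g x) -> (forall y, 0 <= h y) ->
  (forall z, (f z)%:E <= g z.1 + h z.2) ->
  \int[power_probability P n]_x g x <= r%:E ->
  \int[power_probability Q n]_y h y <= r%:E ->
  outer_expectation (power_probability P n \x power_probability Q n) f <= (r + r)%:E.
Proof.
move=> mg mh g0 h0 fgh gr hr.
have mg1 : measurable_fun setT (fun z : n.-tuple X * n.-tuple X => g z.1).
  exact: measurableT_comp.
have mh2 : measurable_fun setT (fun z : n.-tuple X * n.-tuple X => h z.2).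
  exact: measurableT_comp.
apply: (@le_trans _ _ (\int[power_probability P n \x power_probability Q n]_z
    (g z.1 + h z.2))).
  apply: ereal_inf_lbound; exists (fun z => g z.1 + h z.2) => //; split => //.
  exact: emeasurable_funD.
rewrite ge0_integralD// EFinD leeD//.
  rewrite fubini_tonelli1// /fubini_F/=.
  under eq_integral do rewrite integral_cst// [X in _ * X]probability_setT mule1.
  exact: gr.
rewrite fubini_tonelli1// /fubini_F/= integral_cst// [X in _ * X]probability_setT mule1.
exact: hr.
Qed.

End two_samples.

(** This makes [uniform_deviation] available for one set chosen in advance: the
    event of each trace of a single set is a rectangle. *)
Lemma trace_measurable_set1 d (X : measurableType d) (R : realType) (S : set X) :
  measurable S -> trace_measurable R [set S].
Proof.
move=> mS P m I; exists (rectangle (fun i => if `[< I i >] then S else ~` S)).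
  by apply: measurable_rectangle => i; case: ifP => // _; exact: measurableC.
exists set0; first exact: negligible_set0.
rewrite setU0; apply/seteqP; split => [x xI|x [_ /= -> <-] i].
  exists S => //; apply/seteqP; split => i /=; have := xI i; case: asboolP => //.
by case: asboolP.
Qed.

Lemma card_traces_set1 d (X : measurableType d) (S : set X) m (z : m.-tuple X) :
  (#|traces [set S] z| <= 1)%N.
Proof.
rewrite -(finset.cards1 (trace S z)); apply/subset_leq_card/fintype.subsetP => I.
move=> IT; rewrite finset.in_set1; move: IT.
rewrite inE => /asboolP[S' S'S tI]; apply/eqP; rewrite -tI.
by congr (trace _ z); exact: S'S.
Qed.

Section confidence_level.
Variable R : realType.
Implicit Types (delta v : R).

Lemma expR1_le4 : expR 1 <= 4 :> R.
Proof.
have h : expR (2^-1) <= 2 :> R.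
  have := expR_ge1Dx (- 2^-1 : R); rewrite expRN => h.
  rewrite -[leRHS]invrK -[leLHS]invrK lef_pV2 ?posrE ?invr_gt0 ?expR_gt0//.
  by apply: le_trans h; lra.
have -> : expR 1 = expR (2^-1) ^+ 2 :> R by rewrite -expRM_natr mulVf.
have := expR_gt0 (2^-1 : R); rewrite expr2; nra.
Qed.

Lemma ln32_ge1 delta : 0 < delta < 1 -> 1 <= ln (32 / delta).
Proof.
move=> /andP[d0 d1]; rewrite -ler_expR lnK ?posrE ?divr_gt0//.
by apply: (le_trans expR1_le4); rewrite ler_pdivlMr//; lra.
Qed.

Lemma vtau_mulrn (V : \bar R) n delta : (0 < n)%N ->
  n%:R * vtau V n delta = 4 * (fine V * ln (2 * n%:R) + ln (32 / delta)).
Proof. by move=> n0; rewrite /vtau; field; rewrite pnatr_eq0 -lt0n. Qed.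

Lemma expRN_vtau (V : \bar R) n delta : (0 < n)%N -> 0 < delta ->
  expR (- (n%:R * vtau V n delta / 4)) = expR (- (fine V * ln (2 * n%:R))) * (delta / 32).
Proof.
move=> n0 d0; rewrite vtau_mulrn// (_ : 4 * _ / 4 = fine V * ln (2 * n%:R) + ln (32 / delta)).
  by rewrite opprD expRD [X in _ * X]expRN lnK ?posrE ?divr_gt0// invf_div.
by field.
Qed.

End confidence_level.

Theorem theorem4p2 (R : realType) (d : measure_display) (X : measurableType d)
    (delta : R) (SS : set (set X)) (f0 f1 : R -> R) (n : nat) (tau : R) :
  0 < delta < 1 ->
  SS `<=` measurable ->
  (VC R SS < +oo)%E ->
  is_trade_off_function f0 ->
  is_trade_off_function f1 ->
  (forall alpha, 0 <= alpha <= 1 -> f1 alpha <= f0 alpha) ->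
  (0 < n)%N ->
  tau = vtau (VC R SS) n delta ->
  tau <= 2^-1 ->
  (trace_measurable R SS ->
    (ereal_sup
      [set outer_expectation
             (power_probability PQ.1 n \x power_probability PQ.2 n)%E
             (psi SS f0 tau (n:=n))
      | PQ in [set PQ : probability X R * probability X R |
               trade_off_ge PQ.1 PQ.2 f0]] <= delta%:E)%E)
  /\
  (SS set0 -> SS setT ->
    (forall alpha, 0 <= alpha <= 1 ->
      f1 alpha <=
      hplus_inv tau (hplus_inv tau (f0 (hplus tau (hplus tau alpha))))) ->
    (ereal_sup
      [set outer_expectation
             (power_probability PQ.1 n \x power_probability PQ.2 n)%E
             (fun z => (1 - psi SS f0 tau (n:=n) z)%R)
      | PQ in [set PQ : probability X R * probability X R |
               attainable PQ.1 PQ.2 SS /\ trade_off_nge PQ.1 PQ.2 f1]]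
      <= delta%:E)%E).
Proof.
move=> delta01 mSS VCoo tf0 tf1 _ n_gt0 tauE _.
have /andP[delta0 delta1] := delta01.
have v0 := fine_VC_ge0 VCoo.
have ln2n : 0 <= ln (2 * n%:R) :> R.
  by rewrite ln_ge0// -natrM ler1n muln_gt0.
have ntau : 4 <= n%:R * tau.
  rewrite tauE vtau_mulrn//.
  have := ln32_ge1 delta01; have := mulr_ge0 v0 ln2n; lra.
have tau0 : 0 < tau.
  have : 0 < n%:R * tau by lra.
  by rewrite pmulr_rgt0// ltr0n.
pose eps := Num.sqrt tau.
have eps0 : 0 < eps by rewrite sqrtr_gt0.
have epsE : eps ^+ 2 = tau by rewrite sqr_sqrtr// ltW.
have neps : 4 <= n%:R * eps ^+ 2 by rewrite epsE.
have [_ _ f0mono _ _] := tf0.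
have f0le a b : 0 <= a <= 1 -> 0 <= b <= 1 -> a <= b -> f0 b <= f0 a.
  by move=> a01 b01; apply: f0mono; rewrite in_itv.
have h01 t : 0 <= t -> 0 <= hplus tau t <= 1 by apply: hplus01; exact: ltW.
have h01' t : 0 <= t <= 1 -> 0 <= hplus tau t <= 1 by move=> /andP[t0 _]; exact: h01.
have hmono s t : 0 <= s <= 1 -> 0 <= t <= 1 -> s <= t -> hplus tau s <= hplus tau t.
  by move=> s01 t01; apply: hplus_mono; rewrite ?in_itv// ltW.
have emp01 := @empirical01 _ X R n n_gt0.
have empC := @empiricalC _ X R n n_gt0.
have ge1 (a b : \bar R) : (1 <= a)%E -> (0 <= b)%E -> (1 <= a + b)%E.
  by move=> a1 b0; rewrite -[leLHS]adde0 leeD.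
have ge1' (a b : \bar R) : (0 <= a)%E -> (1 <= b)%E -> (1 <= a + b)%E.
  by move=> a1 b0; rewrite -[leLHS]add0e leeD.
split => [tSS|SS0 SST f1f0]; apply: ge_ereal_sup => _ [[P Q] /= PQ <-].
(* Type I: the class bound, with total failure probability delta / 2 *)
- pose K := 2 * expR (fine (VC R SS) * ln (n + n)%:R) : R.
  have tK (z : (n + n).-tuple X) : #|traces SS z|%:R <= K.
    by apply: card_traces_le => //; rewrite addnn -muln2 mulnC; lia.
  have [g [mg g0 gbad gint]] := uniform_deviation P n_gt0 eps0 neps mSS tSS tK.
  have [h [mh h0 hbad hint]] := uniform_deviation Q n_gt0 eps0 neps mSS tSS tK.
  have KE : K * (4 * expR (- (n%:R * eps ^+ 2 / 4))) = delta / 4.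
    rewrite epsE tauE expRN_vtau// /K addnn -muln2 mulnC natrM.
    rewrite expRN; field; rewrite gt_eqF ?expR_gt0//.
  rewrite KE in gint hint.
  apply: le_trans (outer_expectation_sum_le mg mh g0 h0 _ gint hint) _; last first.
    by rewrite lee_fin; lra.
  move=> [x y]; rewrite /psi indicE; case: (boolP (_ \in _)); last first.
    by move=> _; rewrite adde_ge0.
  rewrite inE /= => -[S SS_S rej]; have mS := mSS S SS_S.
  have [xgood|] := pselect (forall S, SS S ->
      two_sided eps (fine (P S)) (empirical R x S)); last first.
    by move=> /gbad gx; exact: ge1.
  have [ygood|] := pselect (forall S, SS S ->
      two_sided eps (fine (Q S)) (empirical R y S)); last first.
    by move=> /hbad hy; exact: ge1'.
  exfalso; move: rej; apply/negP; rewrite -leNgt.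
  have [Px _ _ _] := xgood S SS_S; have [_ _ Qy _] := ygood S SS_S.
  rewrite epsE in Px Qy.
  have P01 := prob01 P mS.
  apply: (@le_trans _ _ (f0 (fine (P S)))).
    by apply: f0le => //; exact/h01'.
  rewrite empC; apply: le_trans Qy; rewrite -(probC Q mS).
  rewrite -lee_fin [leRHS]fineK ?fin_num_measure//; last exact: measurableC.
  apply: le_trans (PQ _ P01) _; apply: ereal_inf_lbound.
  exists (\1_S); last exact: integral_onem_indic.
  have [mI I01] := is_test_indic R mS; split => //.
  by rewrite integral_indic// setIT fineK// fin_num_measure.
(* Type II: a single set, chosen before the data *)
have [att nge] := PQ.
have [S SS_S PQS] := attainable_below_trade_off mSS tf1 att nge.
have mS := mSS S SS_S.
have mS1 : [set S] `<=` measurable by move=> _ ->.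
have tK (z : (n + n).-tuple X) : #|traces [set S] z|%:R <= 1 :> R.
  by rewrite lern1 card_traces_set1.
have tS := @trace_measurable_set1 _ X R S mS.
have [g [mg g0 gbad gint]] := uniform_deviation P n_gt0 eps0 neps mS1 tS tK.
have [h [mh h0 hbad hint]] := uniform_deviation Q n_gt0 eps0 neps mS1 tS tK.
apply: le_trans (outer_expectation_sum_le mg mh g0 h0 _ gint hint) _; last first.
  rewrite lee_fin epsE tauE expRN_vtau//.
  have : expR (- (fine (VC R SS) * ln (2 * n%:R))) <= 1.
    by rewrite expR_le1 oppr_le0 mulr_ge0.
  move=> /(ler_wpM2r (ltW delta0)); lra.
move=> [x y].
have [xgood|] := pselect (forall S', [set S] S' ->
    two_sided eps (fine (P S')) (empirical R x S')); last first.
  move=> /gbad gx; apply: (@le_trans _ _ 1%E); last exact: ge1.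
  by rewrite lee_fin gerBl /psi indicE.
have [ygood|] := pselect (forall S', [set S] S' ->
    two_sided eps (fine (Q S')) (empirical R y S')); last first.
  move=> /hbad hy; apply: (@le_trans _ _ 1%E); last exact: ge1'.
  by rewrite lee_fin gerBl /psi indicE.
have [_ Px _ _] := xgood S erefl; have [_ _ _ Qy] := ygood S erefl.
rewrite epsE in Px Qy.
have P01 := prob01 P mS; have QC01 := prob01 Q (measurableC mS).
rewrite /psi indicE mem_set ?subrr ?adde_ge0//=.
exists S => //.
apply: (@le_lt_trans _ _ (hplus tau (hplus tau (fine (Q (~` S)))))).
  apply: hmono => //; first exact: h01'.
  by rewrite empC probC.
apply: (@lt_le_trans _ _ (f0 (hplus tau (hplus tau (fine (P S)))))).
  apply: lt_hplus_inv; first exact: h01'.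
  apply: lt_hplus_inv => //.
  exact: lt_le_trans (f1f0 _ P01).
apply: f0le; [exact/h01'|exact/h01'/h01'|].
by apply: hmono => //; exact: h01'.
Qed.
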